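(* Let $T$ be a complete first-order theory with monster model $\mathbb{M}$, let $M$ be a small model of $T$ and let $p(x)$ be an $\mathrm{NTP}_2$ partial type over $M$. Let $a$ be a tuple from $p(\mathbb{M})\cup M$ and assume that $\{\phi(x,a)\}\cup p(x)$ does not divide over $M$. Then there is $p'(x)\in S(p(\mathbb{M})\cup M)$ which does not divide over $M$ and such that $\{\phi(x,a)\}\cup p(x)\subset p'(x)$.
   Context: No assumption is made on $T$. $p(\mathbb{M})$ denotes the set of realizations of $p$ in $\mathbb{M}$. A partial type $p(x)$ over $C$ is $\mathrm{NTP}_2$ if there do not exist an array $(a_{\alpha,i})_{\alpha,i<\omega}$, a formula $\phi(x,y)$ and $k<\omega$ such that $\{\phi(x,a_{\alpha,i})\}_{i<\omega}$ is $k$-inconsistent for every $\alpha<\omega$ and $\{\phi(x,a_{\alpha,f(\alpha)})\}_{\alpha<\omega}\cup p(x)$ is consistent for every $f:\omega\to\omega$. A formula $\phi(x,a)$ divides over $A$ if there is an $A$-indiscernible sequence $(a_i)_{i<\omega}$ with $a_0=a$ and $\{\phi(x,a_i)\}_{i<\omega}$ inconsistent; a (partial) type divides over $A$ if it implies a formula which divides over $A$. *)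

(* Defs.v *)
From mathcomp Require Import all_boot.
From mathcomp Require Import boolp classical_sets functions cardinality.

Set Implicit Arguments.
Unset Strict Implicit.
Unset Printing Implicit Defensive.

Local Open Scope classical_set_scope.
Local Open Scope card_scope.

Record language := Language {
  fun_symb : Type;
  fun_arity : fun_symb -> nat;
  rel_symb : Type;
  rel_arity : rel_symb -> nat }.

(* Terms and formulas are indexed by the type V of their free variables; a
   quantifier binds the extra variable [None] of [option V].  A formula
   phi(x, y) with |x| = n and |y| = m is a [formula L ('I_n + 'I_m)]. *)
Inductive term (L : language) (V : Type) : Type :=
| Var of V
| App (f : fun_symb L) of ('I_(fun_arity f) -> term L V).

Inductive formula (L : language) (V : Type) : Type :=
| Falsum
| Equal of term L V & term L V
| Atom (r : rel_symb L) of ('I_(rel_arity r) -> term L V)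
| Imp of formula L V & formula L V
| All of formula L (option V).

Arguments Var {L V}.
Arguments App {L V}.
Arguments Falsum {L V}.
Arguments Equal {L V}.
Arguments Atom {L V}.
Arguments Imp {L V}.
Arguments All {L V}.

Definition Not (L : language) (V : Type) (phi : formula L V) : formula L V :=
  Imp phi Falsum.

Record structure (L : language) := Structure {
  carrier :> Type;
  carrier_nonempty : inhabited carrier;
  fun_interp : forall f : fun_symb L, ('I_(fun_arity f) -> carrier) -> carrier;
  rel_interp : forall r : rel_symb L, ('I_(rel_arity r) -> carrier) -> Prop }.

Fixpoint eval (L : language) (U : structure L) (V : Type) (e : V -> U)
    (t : term L V) : U :=
  match t with
  | Var v => e v
  | App f ts => fun_interp (fun i => eval e (ts i))
  end.

Fixpoint sat (L : language) (U : structure L) (V : Type) (phi : formula L V) :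
    (V -> U) -> Prop :=
  match phi with
  | Falsum => fun _ => False
  | Equal s t => fun e => eval e s = eval e t
  | Atom r ts => fun e => rel_interp (fun i => eval e (ts i))
  | Imp psi chi => fun e => sat psi e -> sat chi e
  | All psi => fun e =>
      forall u : U, sat psi (fun v => if v is Some w then e w else u)
  end.

Definition sentence (L : language) : Type := formula L void.

Definition true_in (L : language) (U : structure L) (sigma : sentence L) : Prop :=
  sat sigma (of_void U).

Definition model_of (L : language) (T : set (sentence L)) (U : structure L) : Prop :=
  forall sigma, T sigma -> true_in U sigma.

Definition theory_entails (L : language) (T : set (sentence L))
    (sigma : sentence L) : Prop :=
  forall U : structure L, model_of T U -> true_in U sigma.

Definition complete_theory (L : language) (T : set (sentence L)) : Prop :=
  (exists U : structure L, model_of T U) /\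
  forall sigma, theory_entails T sigma \/ theory_entails T (Not sigma).

Definition fun_closed (L : language) (U : structure L) (M : set U) : Prop :=
  forall (f : fun_symb L) (a : 'I_(fun_arity f) -> U),
    (forall i, M (a i)) -> M (fun_interp a).

Definition substructure (L : language) (U : structure L) (M : set U)
    (M0 : exists u, M u) (cM : fun_closed M) : structure L :=
  @Structure L {u : U | M u}
    (let: ex_intro u Mu := M0 in inhabits (exist _ u Mu))
    (fun f a => exist _ (fun_interp (fun i => sval (a i)))
                        (cM f (fun i => sval (a i)) (fun i => svalP (a i))))
    (fun r a => rel_interp (fun i => sval (a i))).

Definition elementary_submodel (L : language) (U : structure L) (M : set U) : Prop :=
  exists (M0 : exists u, M u) (cM : fun_closed M),
    forall (k : nat) (phi : formula L 'I_k) (e : 'I_k -> substructure M0 cM),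
      sat phi e <-> @sat L U 'I_k phi (fun i => sval (e i)).

(* A formula phi(x, c) with |x| = n and parameters from U. *)
Record pformula (L : language) (U : structure L) (n : nat) := PFormula {
  pnum : nat;
  pform : formula L ('I_n + 'I_pnum);
  pparam : 'I_pnum -> U }.

Arguments PFormula {L U n pnum}.
Arguments pform {L U n}.
Arguments pparam {L U n}.

Definition psat (L : language) (U : structure L) (n : nat) (psi : pformula U n)
    (x : 'I_n -> U) : Prop :=
  sat (pform psi)
    (fun v => match v with inl i => x i | inr j => pparam psi j end).

Definition pnot (L : language) (U : structure L) (n : nat) (psi : pformula U n) :
    pformula U n :=
  PFormula (Not (pform psi)) (pparam psi).

Definition formula_over (L : language) (U : structure L) (n : nat) (C : set U)
    (psi : pformula U n) : Prop :=
  forall j, C (pparam psi j).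

Definition realizes (L : language) (U : structure L) (n : nat)
    (p : set (pformula U n)) (x : 'I_n -> U) : Prop :=
  forall psi, p psi -> psat psi x.

(* Finite satisfiability in U, i.e. consistency with the elementary diagram
   of U; the set p need not be realized in U when it has many parameters. *)
Definition consistent (L : language) (U : structure L) (n : nat)
    (p : set (pformula U n)) : Prop :=
  forall q : set (pformula U n), finite_set q -> q `<=` p ->
    exists x, realizes q x.

Definition implies (L : language) (U : structure L) (n : nat)
    (p : set (pformula U n)) (psi : pformula U n) : Prop :=
  ~ consistent (p `|` [set pnot psi]).

Definition partial_type (L : language) (U : structure L) (n : nat) (C : set U)
    (p : set (pformula U n)) : Prop :=
  p `<=` formula_over C /\ consistent p.

(* p belongs to S_n(C). *)
Definition complete_type (L : language) (U : structure L) (n : nat) (C : set U)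
    (p : set (pformula U n)) : Prop :=
  partial_type C p /\
  forall psi, formula_over C psi -> p psi \/ p (pnot psi).

(* A cardinal is represented by a type K of that cardinality. *)
Definition smaller_than (K X : Type) (A : set X) : Prop :=
  (A #<= [set: K]) /\ ~ ([set: K] #<= A).

Definition saturated (K : Type) (L : language) (U : structure L) : Prop :=
  forall (A : set U), smaller_than K A ->
  forall (n : nat) (p : set (pformula U n)),
    complete_type A p -> exists x, realizes p x.

Definition automorphism (L : language) (U : structure L) (s : U -> U) : Prop :=
  [/\ bijective s,
      forall (f : fun_symb L) (a : 'I_(fun_arity f) -> U),
        s (fun_interp a) = fun_interp (fun i => s (a i))
    & forall (r : rel_symb L) (a : 'I_(rel_arity r) -> U),
        rel_interp a <-> rel_interp (fun i => s (a i))].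

(* Only the values of f on A matter. *)
Definition partial_elementary (L : language) (U : structure L) (A : set U)
    (f : U -> U) : Prop :=
  forall (k : nat) (phi : formula L 'I_k) (a : 'I_k -> U),
    (forall i, A (a i)) -> (sat phi a <-> sat phi (fun i => f (a i))).

Definition strongly_homogeneous (K : Type) (L : language) (U : structure L) : Prop :=
  forall (A : set U) (f : U -> U), smaller_than K A -> partial_elementary A f ->
    exists s : U -> U, automorphism s /\ (forall u, A u -> s u = f u).

(* The formulas with free variables indexed by nat number |L| + aleph_0, which
   is |T|: the cardinal |K| is thus uncountable and greater than |T|.  The small
   subsets of U are those that are [smaller_than K]. *)
Definition monster_model (L : language) (T : set (sentence L)) (K : Type)
    (U : structure L) : Prop :=
  [/\ model_of T U, smaller_than K [set: formula L nat],
      saturated K U & strongly_homogeneous K U].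

Definition indiscernible (L : language) (U : structure L) (m : nat) (A : set U)
    (s : nat -> 'I_m -> U) : Prop :=
  forall (k l : nat) (phi : formula L ('I_k * 'I_m + 'I_l)) (c : 'I_l -> U)
         (i j : 'I_k -> nat),
    (forall t, A (c t)) ->
    (forall t t' : 'I_k, t < t' -> i t < i t') ->
    (forall t t' : 'I_k, t < t' -> j t < j t') ->
    (sat phi (fun v => match v with inl tr => s (i tr.1) tr.2 | inr t => c t end) <->
     sat phi (fun v => match v with inl tr => s (j tr.1) tr.2 | inr t => c t end)).

Definition formula_divides (L : language) (U : structure L) (n : nat) (A : set U)
    (psi : pformula U n) : Prop :=
  exists s : nat -> 'I_(pnum psi) -> U,
    [/\ indiscernible A s, s 0 =1 pparam psi
      & ~ consistent (range (fun i => PFormula (pform psi) (s i)))].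

Definition type_divides (L : language) (U : structure L) (n : nat) (A : set U)
    (p : set (pformula U n)) : Prop :=
  exists psi, implies p psi /\ formula_divides A psi.

Definition k_inconsistent (L : language) (U : structure L) (n k : nat)
    (psi : nat -> pformula U n) : Prop :=
  forall i : 'I_k -> nat, injective i -> ~ consistent (range (fun t => psi (i t))).

Definition NTP2 (L : language) (U : structure L) (n : nat)
    (p : set (pformula U n)) : Prop :=
  ~ exists (m : nat) (a : nat -> nat -> 'I_m -> U)
           (phi : formula L ('I_n + 'I_m)) (k : nat),
      (forall alpha, k_inconsistent k (fun i => PFormula phi (a alpha i))) /\
      (forall f : nat -> nat,
         consistent (range (fun alpha => PFormula phi (a alpha (f alpha))) `|` p)).

(* The set p(U) `|` M, where n-tuples realizing p contribute their coordinates. *)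
Definition realizations_and (L : language) (U : structure L) (n : nat)
    (p : set (pformula U n)) (M : set U) : set U :=
  [set u | exists x : 'I_n -> U, realizes p x /\ exists i, u = x i] `|` M.

(* Main.v *)
Require Import Defs.
From Stdlib Require List.
From mathcomp Require Import all_boot.
From mathcomp Require Import boolp classical_sets functions cardinality filter.

(* Everything is done with coheirs over M, given as ultrafilters D on M-points:
   the Morley sequences of the global type defined by D are read off by iterating
   the quantifier "for D-almost all m".
   (1) By NTP2, a formula dividing over M divides, together with p, along a coheir
   (take a coheir of a whole indiscernible sequence and look at the paths of the
   resulting array).
   (2) The broom lemma: a disjunction of formulas psi_i(z, c), each dividing along
   a coheir of tp(c/M), has an inconsistent finite conjunction of M-conjugates.
   Hence tp(c/M) has a strict coheir R: if e realizes R over Mb, then tp(b/Me)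
   does not divide along coheirs of tp(c/M).  Restricting attention to dividing
   along coheirs makes this true in every theory.
   (3) By NTP2 again, what divides along some coheir of tp(c/M) divides, together
   with p, along R.
   Now suppose p and phi(x, a) imply a finite disjunction of dividing formulas.  Let
   c contain a and all the parameters, and let (c^j) be a Morley sequence of R with
   c^0 = c.  If p were consistent with all phi(x, a^j), the pigeonhole principle
   would make one of the disjuncts hold along a subsequence, against (3).  So
   phi(x, a) together with p divides.  Finally p' is cut out of an ultrafilter
   containing p, phi(x, a) and the negations of all dividing formulas. *)

Set Implicit Arguments.
Unset Strict Implicit.
Unset Printing Implicit Defensive.

Local Open Scope classical_set_scope.
Local Open Scope card_scope.

(** * Syntax *)

Fixpoint rename_term (L : language) (V W : Type) (g : V -> W) (t : term L V) :
    term L W :=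
  match t with
  | Var v => Var (g v)
  | App f ts => App f (fun i => rename_term g (ts i))
  end.

Fixpoint rename (L : language) (V : Type) (phi : formula L V) :
    forall W : Type, (V -> W) -> formula L W :=
  match phi with
  | Falsum => fun W g => Falsum
  | Equal s t => fun W g => Equal (rename_term g s) (rename_term g t)
  | Atom r ts => fun W g => Atom r (fun i => rename_term g (ts i))
  | Imp psi chi => fun W g => Imp (rename psi g) (rename chi g)
  | All psi => fun W g => All (rename psi (omap g))
  end.

Lemma eval_rename (L : language) (U : structure L) (V W : Type) (g : V -> W)
    (t : term L V) (e : W -> U) :
  eval e (rename_term g t) = eval (e \o g) t.
Proof. by elim: t => //= f ts IH; congr fun_interp; apply/funext. Qed.

Lemma sat_rename (L : language) (U : structure L) (V : Type) (phi : formula L V) :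
  forall (W : Type) (g : V -> W) (e : W -> U),
  sat (rename phi g) e = sat phi (e \o g).
Proof.
elim: phi => {V} [V|V s t|V r ts|V psi IH1 chi IH2|V psi IH] W g e //=.
- by rewrite !eval_rename.
- by congr rel_interp; apply/funext => i; rewrite eval_rename.
- by rewrite IH1 IH2.
- apply: eq_forall => u; rewrite IH; congr (sat psi).
  by apply/funext => -[].
Qed.

Lemma sat_ext (L : language) (U : structure L) (V : Type) (phi : formula L V)
    (e e' : V -> U) : e =1 e' -> sat phi e -> sat phi e'.
Proof. by move=> /funext ->. Qed.

Definition supported_on (L : language) (V : Type) (s : seq V) (phi : formula L V) :=
  forall (U : structure L) (e e' : V -> U),
    (forall v, List.In v s -> e v = e' v) -> sat phi e -> sat phi e'.

Lemma term_support (L : language) (V : Type) (t : term L V) :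
  exists s : seq V, forall (U : structure L) (e e' : V -> U),
    (forall v, List.In v s -> e v = e' v) -> eval e t = eval e' t.
Proof.
elim: t => [v|f ts IH].
  by exists [:: v] => U e e' /= h; apply: h; left.
have [s hs] := choice IH.
exists (flatten [seq s i | i <- enum 'I_(fun_arity f)]) => U e e' h /=.
congr fun_interp; apply/funext => i; apply: hs => v hv; apply: h.
have : i \in enum 'I_(fun_arity f) by rewrite mem_enum.
elim: (enum _) => //= j r IHr; rewrite inE => /orP[/eqP<-|/IHr]; last first.
  by move=> ?; apply/List.in_or_app; right.
by apply/List.in_or_app; left.
Qed.

Lemma formula_support (L : language) (V : Type) (phi : formula L V) :
  exists s : seq V, supported_on s phi.
Proof.
elim: phi => {V} [V|V s t|V r ts|V psi [s1 h1] chi [s2 h2]|V psi [s h]].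
- by exists [::].
- have [s1 h1] := term_support s; have [s2 h2] := term_support t.
  exists (s1 ++ s2) => U e e' h /=; rewrite (h1 U e e') ?(h2 U e e') //.
    by move=> v hv; apply: h; apply/List.in_or_app; right.
  by move=> v hv; apply: h; apply/List.in_or_app; left.
- have [s hs] := choice (fun i => term_support (ts i)).
  exists (flatten [seq s i | i <- enum 'I_(rel_arity r)]) => U e e' h /=.
  suff -> : (fun i => eval e (ts i)) = (fun i => eval e' (ts i)) by [].
  apply/funext => i; apply: hs => v hv; apply: h.
  have : i \in enum 'I_(rel_arity r) by rewrite mem_enum.
  elim: (enum _) => //= j q IHr; rewrite inE => /orP[/eqP<-|/IHr]; last first.
    by move=> ?; apply/List.in_or_app; right.
  by apply/List.in_or_app; left.
- exists (s1 ++ s2) => U e e' h /= H H1; apply: h2 (H (h1 _ _ _ _ H1)) => v hv.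
    by apply: h; apply/List.in_or_app; right.
  by symmetry; apply: h; apply/List.in_or_app; left.
- exists (pmap id s) => U e e' hh /= H u; apply: h (H u) => -[v|] //= hv.
  apply: hh; elim: s hv => //= -[w|] r IH /= [] //.
  + by case=> ->; left.
  + by move/IH; right.

Qed.

(* Only the finitely many quantified variables in the support matter, and they
   are eliminated one by one; [v0] absorbs the variables that do not occur. *)
Lemma ex_block (L : language) (V W : Type) (v0 : V) (phi : formula L (V + W)) :
  exists phi' : formula L V, forall (U : structure L) (e : V -> U),
    sat phi' e <-> exists w : W -> U, sat phi (fun x => match x with
                                                | inl v => e v | inr y => w y end).
Proof.
have [s0 hs0] := formula_support phi.
have [s hs] : exists s : seq W, forall (U : structure L) (e e' : V + W -> U),
    (forall v, e (inl v) = e' (inl v)) ->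
    (forall w, List.In w s -> e (inr w) = e' (inr w)) ->
    sat phi e -> sat phi e'.
  exists (pmap (fun x => if x is inr w then Some w else None) s0).
  move=> U e e' h1 h2; apply: hs0 => -[v|w] hv; first exact: h1.
  apply: h2; elim: s0 hv => //= -[v|y] r IH /= [] //.
  - by case=> ->; left.
  - by move/IH; right.
elim: s V v0 phi hs {s0 hs0} => [|w0 s IH] V v0 phi hs.
  exists (rename phi (fun x => if x is inl v then v else v0)) => U e.
  rewrite sat_rename; split=> [H|[w H]].
    by exists (fun=> e v0); apply: hs H => //.
  by apply: hs H.
(* The variable [w0] becomes the bound variable [None] of a new quantifier; the induction hypothesis
   eliminates the remaining ones. *)
pose g (x : V + W) : option V + W :=
  match x with
  | inl v => inl (Some v)
  | inr w => if pselect (w = w0) then inl None else inr w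
  end.
have [|psi hpsi] := IH (option V) None (rename phi g).
  move=> U e e' h1 h2; rewrite !sat_rename; apply: hs => [v|w] /=; first exact: h1.
  by case: pselect => [? ?|wn [ww|hw]]; [exact: h1|case: wn|exact: h2].
exists (Not (All (Not psi))) => U e /=; split.
  apply: contra_notP => hn u /hpsi[w]; rewrite sat_rename => H; apply: hn.
  exists (fun y => if pselect (y = w0) then u else w y).
  apply: hs H => [v|y] //= _; rewrite /g; case: pselect => //.
case=> w H; move/(_ (w w0)); apply; apply/hpsi; exists w; rewrite sat_rename.
apply: hs H => [v|y] //= _; rewrite /g; case: pselect => //= ->//.
Qed.

(** * Ultrafilters *)

Definition ultra (X : Type) (D : (X -> Prop) -> Prop) : Prop :=
  [/\ forall P Q : X -> Prop, (forall x, P x -> Q x) -> D P -> D Q,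
      forall P Q : X -> Prop, D P -> D Q -> D (fun x => P x /\ Q x)
    & forall P : X -> Prop, D (fun x => ~ P x) <-> ~ D P].

Section Ultra.
Variables (X : Type) (D : (X -> Prop) -> Prop).
Hypothesis uD : ultra D.

Lemma ultra_mono (P Q : X -> Prop) : (forall x, P x -> Q x) -> D P -> D Q.
Proof. by case: uD => h _ _; apply: h. Qed.

Lemma ultra_and (P Q : X -> Prop) : D P -> D Q -> D (fun x => P x /\ Q x).
Proof. by case: uD => _ h _; apply: h. Qed.

Lemma ultra_not (P : X -> Prop) : D (fun x => ~ P x) <-> ~ D P.
Proof. by case: uD. Qed.

Lemma ultra_true (P : X -> Prop) : (forall x, P x) -> D P.
Proof.
move=> h; apply: contrapT => /ultra_not hn.
have : ~ D P by apply/ultra_not.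
by apply; apply: ultra_mono hn.
Qed.

Lemma ultra_mono2 (P Q R : X -> Prop) :
  (forall x, P x -> Q x -> R x) -> D P -> D Q -> D R.
Proof.
by move=> h DP DQ; apply: ultra_mono (ultra_and DP DQ) => x []; apply: h.
Qed.

Lemma ultra_ex (P : X -> Prop) : D P -> exists x, P x.
Proof.
move=> DP; apply: contrapT => hn.
have : D (fun x => ~ P x) by apply: ultra_true => x px; apply: hn; exists x.
by move/ultra_not; apply.
Qed.

Lemma ultra_forall_seq (T : eqType) (P : T -> X -> Prop) (s : seq T) :
  (forall t, t \in s -> D (P t)) -> D (fun x => forall t, t \in s -> P t x).
Proof.
elim: s => [|t s IH] h; first exact: ultra_true.
apply: ultra_mono2 (h t (mem_head _ _)) (IH _) => [x h1 h2 u|u us].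
  by rewrite inE => /orP[/eqP->//|/h2].
by apply: h; rewrite inE us orbT.
Qed.

Lemma ultra_forall (I : finType) (P : I -> X -> Prop) :
  (forall i, D (P i)) -> D (fun x => forall i, P i x).
Proof.
move=> h; apply: ultra_mono (ultra_forall_seq (s := enum I) (fun i _ => h i)).
by move=> x hx i; apply: hx; rewrite mem_enum.
Qed.

Lemma ultra_forall_lt (P : nat -> X -> Prop) (k : nat) :
  (forall i, i < k -> D (P i)) -> D (fun x => forall i, i < k -> P i x).
Proof.
move=> h; apply: ultra_mono (@ultra_forall 'I_k (fun i => P i) _) => [x hx i ik|i].
  exact: (hx (Ordinal ik)).
exact: h.
Qed.

End Ultra.

Definition fip (X : Type) (B : (X -> Prop) -> Prop) : Prop :=
  forall (N : nat) (P : nat -> X -> Prop),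
    (forall i, i < N -> B (P i)) -> exists x, forall i, i < N -> P i x.

Lemma ultra_fip (X : Type) (B : (X -> Prop) -> Prop) :
  fip B -> exists2 D, ultra D & forall P, B P -> D P.
Proof.
move=> fB.
pose F : set_system X := [set Q | exists N P,
  (forall i, i < N -> B (P i)) /\ (forall x, (forall i, i < N -> P i x) -> Q x)].
have FF : ProperFilter F.
  split.
    by move=> [N [P [h1 h2]]]; have [x hx] := fB N P h1; apply: h2 hx.
  split.
  - by exists 0, (fun _ _ => True).
  - move=> Q1 Q2 [N1 [P1 [h1 k1]]] [N2 [P2 [h2 k2]]].
    exists (N1 + N2), (fun i => if i < N1 then P1 i else P2 (i - N1)); split.
      move=> i; case: ifP => [/h1//|]; move/negbT; rewrite -leqNgt => le lt.
      by apply: h2; rewrite ltn_subLR.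
    move=> x h; split.
      by apply: k1 => i lt; have := h i; rewrite lt; apply; rewrite ltn_addr.
    apply: k2 => i lt; have := h (N1 + i).
    have -> : (N1 + i < N1) = false by rewrite ltnNge leq_addr.
    by rewrite addKn ltn_add2l; apply.
  - by move=> Q1 Q2 sub [N [P [h1 h2]]]; exists N, P; split=> // x /h2/sub.
have [G [UG sFG]] := ultraFilterLemma FF.
exists G.
  split=> [P Q sPQ|P Q|P]; first exact: filterS.
    exact: filterI.
  split=> [GnP GP|nGP].
    have [x []] := filter_ex (filterI GP GnP); by [].
  by have [] := in_ultra_setVsetC P UG.
move=> P BP; apply: sFG; exists 1, (fun=> P); split=> // x h; exact: (h 0).
Qed.

(** * Small sets *)

(** Hilbert's hotel: [g] sends [u] to the first term of a sequence [f] of distinct points of [A],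
    moves each [f i] to [f i.+1] and fixes everything else. *)
Lemma card_le_setU1 (X : Type) (A : set X) (u : X) :
  infinite_set A -> (A `|` [set u]) #<= A.
Proof.
move=> /infiniteP /card_leP[f0].
pose f (i : nat) : X := set_val (f0 (to_setT i)).
have fA i : A (f i) by apply: set_valP.
have finj i j : f i = f j -> i = j.
  move=> /val_inj h; have : to_setT i = to_setT j by apply: inj h; rewrite inE.
  by move/(congr1 set_val).
have [Au|nAu] := pselect (A u).
  by rewrite (_ : A `|` [set u] = A) ?card_lexx // eqEsubset; split=> x; [case=> // ->|left].
pose g x := if pselect (x = u) then f 0 else
  if pselect (exists i, x = f i) is left h then f (sval (cid h)).+1 else x.
apply: (@card_le_trans _ _ _ (g @` (A `|` [set u]))); last first.
  apply: subset_card_le => _ [x Ax <-]; rewrite /g.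
  case: pselect => [?|xu]; first exact: fA.
  by case: pselect => [?|?]; [exact: fA|case: Ax].
have ginj : set_inj (A `|` [set u]) g.
  move=> x y _ _; rewrite /g.
  case: (pselect (x = u)) => xu /=; case: (pselect (y = u)) => yu /=.
  - by rewrite xu yu.
  - case: pselect => h /= e; first by move/finj: e.
    by case: h; eexists; rewrite -e; reflexivity.
  - case: pselect => h /= e; first by move/finj: e.
    by case: h; eexists; rewrite e; reflexivity.
  - case: (pselect (exists i, x = f i)) => h /=;
      case: (pselect (exists i, y = f i)) => k //= e.
    + by case: (cid h) (cid k) e => i xi [j yj] /= /finj [ij]; rewrite xi yj ij.
    + by case: k; eexists; rewrite -e; reflexivity.
    + by case: h; eexists; rewrite e; reflexivity.
by have /card_eqPle[] := inj_card_eq ginj.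
Qed.

(** The equations between variables already give infinitely many formulas, so [K] is infinite, which
    settles finite [A]; an infinite [A] absorbs the points of [F] one by one. *)
Lemma smaller_setU_finite (L : language) (K X : Type) (A F : set X) :
  smaller_than K [set: formula L nat] -> smaller_than K A -> finite_set F ->
  smaller_than K (A `|` F).
Proof.
move=> [LK nKL] sA finF.
have natL : [set: nat] #<= [set: formula L nat].
  pose f n : formula L nat := Equal (Var n) (Var 0).
  have finj : set_inj [set: nat] f by move=> i j _ _ [].
  have /card_eqPle[_ h] := inj_card_eq finj.
  exact: card_le_trans h (card_leT _).
have [finA|infA] := pselect (finite_set A).
  have fin : finite_set (A `|` F) by rewrite finite_setU.
  split.
    apply: card_le_trans (card_le_trans natL LK).
    by have /finite_set_countable := fin.
  move=> h; move: fin; rewrite finite_setPn; apply.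
  exact: card_le_trans natL (card_le_trans LK h).
have hF : (A `|` F) #<= A.
  have [s ->] := (proj1 (@finite_seqP {classic X} _) finF).
  elim: s => [|u s IH].
    by rewrite (_ : _ `|` _ = A) ?card_lexx // eqEsubset; split=> x; [case|left].
  rewrite (_ : _ `|` _ = (A `|` [set` s]) `|` [set u]); last first.
    rewrite eqEsubset; split=> x /=; rewrite ?inE.
      by case=> [|/orP[/eqP|]]; [left; left|right|left; right].
    by case=> [[|xs]|e]; [left|right; rewrite xs orbT|right; apply/orP; left; apply/eqP].
  apply: card_le_trans (card_le_setU1 _ _) IH => fin; apply: infA.
  by apply: sub_finite_set fin => x; left.
have [AK nKA] := sA; split; first exact: card_le_trans hF AK.
by move=> h; apply: nKA; apply: card_le_trans h hF.
Qed.

(** * Definable sets *)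

Definition copair (X V W : Type) (v : V -> X) (w : W -> X) (x : V + W) : X :=
  match x with inl y => v y | inr y => w y end.

(** Working with sets instead of formulas lets [V] be infinite and every element of [A] serve as a
    constant; [definable_split] gives back a formula with a finite parameter tuple. *)
Definition definable (L : language) (U : structure L) (A : set U) (V : Type)
    (S : (V -> U) -> Prop) : Prop :=
  exists phi : formula L (V + {u | A u}), forall v, S v <-> sat phi (copair v sval).

Section Definable.
Variables (L : language) (U : structure L) (A : set U).
Implicit Types V W : Type.

Lemma definable_ext V (S S' : (V -> U) -> Prop) :
  (forall v, S v <-> S' v) -> definable A S -> definable A S'.
Proof. by move=> h [phi hphi]; exists phi => v; rewrite -h. Qed.

Lemma definable_subst V W (h : W -> V + {u | A u}) (S : (W -> U) -> Prop) :
  definable A S -> definable A (fun v => S (copair v sval \o h)).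
Proof.
move=> [phi hphi]; exists (rename phi (copair h inr)) => v.
by rewrite hphi sat_rename; split; apply: sat_ext => -[].
Qed.

Lemma definable_rename V W (h : W -> V) (S : (W -> U) -> Prop) :
  definable A S -> definable A (fun v => S (v \o h)).
Proof. exact: (@definable_subst V W (inl \o h)). Qed.

Lemma definable_mono (B : set U) V (S : (V -> U) -> Prop) :
  A `<=` B -> definable A S -> definable B S.
Proof.
move=> AB [phi hphi].
exists (rename phi (copair inl (fun a => inr (exist _ (sval a) (AB _ (svalP a)))))) => v.
by rewrite hphi sat_rename; split; apply: sat_ext => -[].
Qed.

Lemma definable_imp V (S S' : (V -> U) -> Prop) :
  definable A S -> definable A S' -> definable A (fun v => S v -> S' v).
Proof. by move=> [f hf] [g hg]; exists (Imp f g) => v; rewrite hf hg. Qed.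

Lemma definable_const V (P : Prop) : definable A (fun _ : V -> U => P).
Proof.
have [p|np] := pselect P; last by exists Falsum.
by exists (Imp Falsum Falsum) => v; split=> //= _; apply.
Qed.

Lemma definable_not V (S : (V -> U) -> Prop) :
  definable A S -> definable A (fun v => ~ S v).
Proof. by move=> dS; exact: (definable_imp dS (definable_const V False)). Qed.

Lemma definable_and V (S S' : (V -> U) -> Prop) :
  definable A S -> definable A S' -> definable A (fun v => S v /\ S' v).
Proof.
move=> dS dS'; apply: definable_ext (definable_not (definable_imp dS (definable_not dS'))).
move=> v; split=> [h|[h h'] k]; last exact: k h h'.
by split; apply: contrapT => k; apply: h => // ?.
Qed.

Lemma definable_forall_seq V (T : eqType) (P : T -> (V -> U) -> Prop) (s : seq T) :
  (forall t, t \in s -> definable A (P t)) ->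
  definable A (fun v => forall t, t \in s -> P t v).
Proof.
elim: s => [|t s IH] h.
  by apply: definable_ext (definable_const _ True) => v.
apply: definable_ext (definable_and (h t (mem_head _ _)) (IH _)) => [v|u us].
  split=> [[h1 h2] u|k]; first by rewrite inE => /orP[/eqP->//|/h2].
  by split=> [|u us]; apply: k; rewrite inE ?eqxx ?us ?orbT.
by apply: h; rewrite inE us orbT.
Qed.

Lemma definable_forall V (I : finType) (P : I -> (V -> U) -> Prop) :
  (forall i, definable A (P i)) -> definable A (fun v => forall i, P i v).
Proof.
move=> h; apply: definable_ext (definable_forall_seq (s := enum I) (fun i _ => h i)) => v.
by split=> k i; [apply: k; rewrite mem_enum|move=> _; apply: k].
Qed.

Lemma definable_forall_lt V (P : nat -> (V -> U) -> Prop) (k : nat) :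
  (forall i, i < k -> definable A (P i)) ->
  definable A (fun v => forall i, i < k -> P i v).
Proof.
move=> h; apply: definable_ext (@definable_forall V 'I_k (fun i => P i) _) => [v|i].
  by split=> hv i => [ik|]; [exact: (hv (Ordinal ik))|apply: hv].
exact: h.
Qed.

Lemma definable_ex (a0 : {u | A u}) V W (S : (V + W -> U) -> Prop) :
  definable A S -> definable A (fun v => exists w : W -> U, S (copair v w)).
Proof.
move=> [phi hphi].
pose g (x : (V + W) + {u | A u}) : (V + {u | A u}) + W :=
  match x with
  | inl (inl v) => inl (inl v) | inl (inr w) => inr w | inr a => inl (inr a)
  end.
have [psi hpsi] := ex_block (inr a0) (rename phi g).
exists psi => v; rewrite hpsi; split=> -[w hw]; exists w; move: hw;
  by rewrite hphi sat_rename; apply: sat_ext => -[[]|].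
Qed.

Lemma definable_support V (S : (V -> U) -> Prop) : definable A S ->
  exists s : seq V, forall v v' : V -> U,
    (forall x, List.In x s -> v x = v' x) -> S v -> S v'.
Proof.
move=> [phi hphi]; have [s hs] := formula_support phi.
exists (pmap (fun x => if x is inl v then Some v else None) s) => v v' h.
rewrite !hphi; apply: hs => -[x|//] hx /=; apply: h.
elim: s hx => //= -[y|a] r IH /= [] //.
- by case=> ->; left.
- by move/IH; right.
Qed.

Lemma seq_index (T : Type) (d : T) (s : seq T) :
  exists i : T -> 'I_(size s).+1, forall x, List.In x s -> nth d s (i x) = x.
Proof.
suff: forall x, exists i : 'I_(size s).+1, List.In x s -> nth d s i = x.
  by move=> h; have [i hi] := choice h; exists i.
move=> x; have [xs|nxs] := pselect (List.In x s); last by exists ord0 => /nxs.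
have [i [ib ix]] : exists i, i < size s /\ nth d s i = x.
  elim: s xs => //= y s IH [->|/IH[i [h1 h2]]]; first by exists 0.
  by exists i.+1.
by exists (Ordinal (ltnW ib : i < (size s).+1)).
Qed.

(** A formula mentions only finitely many variables of [W] and constants of [A]; [h] lists them as a
    finite tuple, padded by [a0]. *)
Lemma definable_split (a0 : {u | A u}) V W (S : (V + W -> U) -> Prop) :
  definable A S -> exists (l : nat) (phi : formula L (V + 'I_l))
    (h : 'I_l -> W + {u | A u}),
    forall x w, S (copair x w) <-> sat phi (copair x (copair w sval \o h)).
Proof.
move=> [phi hphi]; have [s hs] := formula_support phi.
pose f (x : (V + W) + {u | A u}) : option (W + {u | A u}) :=
  match x with
  | inl (inl _) => None | inl (inr w) => Some (inl w) | inr a => Some (inr a)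
  end.
have [i hi] := seq_index (inr a0) (pmap f s).
pose g (x : (V + W) + {u | A u}) : V + 'I_(size (pmap f s)).+1 :=
  match x with
  | inl (inl j) => inl j | inl (inr w) => inr (i (inl w)) | inr a => inr (i (inr a))
  end.
exists (size (pmap f s)).+1, (rename phi g), (fun j => nth (inr a0) (pmap f s) j) => x w.
rewrite hphi sat_rename.
have hf y z : f y = Some z -> List.In y s -> List.In z (pmap f s).
  move=> fyz; elim: (s) => //= t r IH [->|/IH]; rewrite ?fyz; first by left.
  by case: (f t) => //= ? ?; right.
split; apply: hs => -[[j|y]|y] // hy /=; rewrite hi //; exact: hf hy.
Qed.

End Definable.

Lemma definable_pformula (L : language) (U : structure L) (A : set U) (n : nat)
    (S : ('I_n -> U) -> Prop) (a0 : {u | A u}) :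
  definable A S -> exists psi : pformula U n,
    formula_over A psi /\ forall x, S x <-> psat psi x.
Proof.
move=> dS.
have dS' : definable A (fun v : 'I_n + void -> U => S (v \o inl)).
  exact: definable_rename dS.
have [l [phi [h hphi]]] := definable_split a0 dS'.
exists (PFormula phi (copair (of_void U) sval \o h)); split.
  by move=> j /=; case: (h j) => [[]|a] /=; apply: svalP.
by move=> x; apply: (hphi x (of_void U)).
Qed.

Lemma pformula_definable (L : language) (U : structure L) (A : set U) (n : nat)
    (psi : pformula U n) : formula_over A psi -> definable A (psat psi).
Proof.
move=> hpsi; exists (rename (pform psi) (fun x => match x with
  | inl i => inl i | inr j => inr (exist _ (pparam psi j) (hpsi j)) end)) => v.
by rewrite sat_rename /psat; split; apply: sat_ext => -[].
Qed.

(** * Elementary submodels and the Tarski-Vaught test *)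

Section Elementary.
Variables (L : language) (U : structure L) (M : set U).
Hypothesis elM : elementary_submodel M.

Lemma elementary_point : exists u, M u.
Proof. by case: elM. Qed.

Lemma tarski_vaught (V : Type) (S : (V -> U) -> Prop) :
  definable M S -> (exists v, S v) -> exists2 v, (forall x, M (v x)) & S v.
Proof.
case: elM => M0 [cM el] [phi hphi] [v Sv].
have [u0 Mu0] := M0.
(* Elementarity, given for variables in ['I_k], extends to any nonempty type of variables by
   renaming a finite support. *)
have elV (W : Type) (w0 : W) (f : formula L W) (e : W -> substructure M0 cM) :
    sat f e <-> @sat L U W f (fun w => sval (e w)).
  have [s hs] := formula_support f; have [i hi] := seq_index w0 s.
  have := el _ (rename f i) (fun j => e (nth w0 s j)); rewrite !sat_rename => h.
  split=> H.
    by apply: hs (h.1 (hs _ _ _ _ H)) => w hw /=; rewrite hi.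
  by apply: hs (h.2 (hs _ _ _ _ H)) => w hw /=; rewrite hi.
pose g (x : V + {u | M u}) : {u | M u} + V :=
  match x with inl v => inr v | inr a => inl a end.
have [psi hpsi] := ex_block (exist _ u0 Mu0) (rename phi g).
have : @sat L U _ psi sval.
  apply/hpsi; exists v; rewrite sat_rename; move/hphi: Sv.
  by apply: sat_ext => -[].
move/(elV {u | M u} (exist _ u0 Mu0) psi id)/hpsi => [w].
rewrite sat_rename => /(elV _ (inr (exist _ u0 Mu0))) hw.
exists (fun x => sval (w x)) => [x|]; first exact: svalP.
by apply/hphi; move: hw; apply: sat_ext => -[].
Qed.

End Elementary.

(** * Realizing types in a saturated structure *)

Lemma ultra_finite (X T : Type) (D : (X -> Prop) -> Prop) (P : T -> X -> Prop)
    (q : set T) :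
  ultra D -> finite_set q -> (forall t, q t -> D (P t)) ->
  D (fun x => forall t, q t -> P t x).
Proof.
move=> uD /(@finite_seqP {classic T})[s ->] h.
exact: (@ultra_forall_seq _ _ uD {classic T} P s).
Qed.

Section Realization.
Variables (K : Type) (L : language) (U : structure L).
Hypothesis satU : saturated K U.

(** The formulas over [A] that hold [G]-almost everywhere form a complete type, to which saturation
    applies. *)
Lemma realize_finitary (A : set U) (a0 : {u | A u}) (n : nat)
    (B : (('I_n -> U) -> Prop) -> Prop) :
  smaller_than K A -> (forall S, B S -> definable A S) -> fip B ->
  exists x, forall S, B S -> S x.
Proof.
move=> sA dB /ultra_fip[G uG BG].
have [|x hx] := satU sA (p := [set psi | formula_over A psi /\ G (psat psi)]).
  split.
    split=> [psi []//|q fq qp].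
    have /ultra_ex := ultra_finite (P := @psat L U n) uG fq (fun psi h => (qp psi h).2).
    by apply.
  move=> psi hpsi; have [GP|/(ultra_not uG) GnP] := pselect (G (psat psi)).
    by left.
  by right; split.
exists x => S BS; have [psi [h1 h2]] := definable_pformula a0 (dB S BS).
apply/h2; apply: hx; split=> //; apply: ultra_mono uG _ _ _ (BG S BS) => y.
by move/h2.
Qed.

(* The realization is built one variable at a time: at stage [N] the variables
   of code less than [N] have been given their final value. *)
Lemma realize_countable (A : set U) (a0 : {u | A u}) (V : countType)
    (B : ((V -> U) -> Prop) -> Prop) :
  (forall F, finite_set F -> smaller_than K (A `|` F)) ->
  (forall S, B S -> definable A S) -> fip B ->
  exists e, forall S, B S -> S e.
Proof.
move=> sA dB /ultra_fip[G uG BG].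
pose below (N : nat) (S : (V -> U) -> Prop) := forall e e' : V -> U,
  (forall w, pickle w < N -> e w = e' w) -> S e -> S e'.
(* Invariant: [e] meets every [G]-large definable condition that depends only on the variables of
   code less than [N]. *)
pose good N (e : V -> U) := forall S, definable A S -> below N S -> G S -> S e.
have good0 : good 0 (fun=> sval a0).
  by move=> S _ h /(ultra_ex uG)[v Sv]; apply: h Sv.
have step N (e : V -> U) : good N e ->
    exists e', (forall w, pickle w < N -> e' w = e w) /\ good N.+1 e'.
  move=> ge; have [[w0 w0N]|nw] := pselect (exists w0 : V, pickle w0 = N); last first.
    exists e; split=> // S dS hS GS; apply: ge => // e1 e2 h; apply: hS => w.
    by rewrite ltnS leq_eqVlt => /orP[/eqP wN|/h//]; case: nw; exists w.
  pose upd (v : V -> U) u := fun w => if w == w0 then u else v w.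
  (* Resetting the later variables to [a0] leaves only the finitely many values in [F] as extra
     parameters. *)
  pose es w := if pickle w < N then e w else sval a0.
  pose F : set U := [set u | exists2 w, pickle w < N & u = e w].
  have finF : finite_set F.
    pose g i : U := if unpickle i is Some w then e (w : V) else sval a0.
    apply: (@sub_finite_set _ _ (g @` `I_N)); last exact: finite_image (finite_II _).
    by move=> _ [w wN ->]; exists (pickle w) => //; rewrite /g pickleK.
  have AFa0 : (A `|` F) (sval a0) by left; apply: svalP.
  have esAF w : (A `|` F) (es w).
    by rewrite /es; case: ifP => // wN; right; exists w.
  have updP (S : (V -> U) -> Prop) v v' u : below N.+1 S ->
      (forall w, pickle w < N -> v w = v' w) -> S (upd v u) -> S (upd v' u).
    move=> bS h; apply: bS => w; rewrite ltnS leq_eqVlt /upd.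
    case: (w =P w0) => // ww0 /orP[/eqP|/h//].
    by rewrite -w0N => /(pcan_inj (@pickleK V)).
  have ees w : pickle w < N -> e w = es w by rewrite /es => ->.
  have [_ [S [dS bS GS ->]]|k P hP|x hx] :=
    @realize_finitary _ (exist _ _ AFa0) 1
      (fun Q => exists S, [/\ definable A S, below N.+1 S, G S &
         Q = fun x => S (upd es (x ord0))]) (sA F finF).
  - pose h (w : V) : 'I_1 + {u | (A `|` F) u} :=
      if w == w0 then inl ord0 else inr (exist _ _ (esAF w)).
    have := definable_subst h (definable_mono (@subsetUl _ A F) dS).
    apply: definable_ext => v.
    suff -> : copair v sval \o h = upd es (v ord0) by [].
    by apply/funext => w; rewrite /= /h /upd; case: eqP.
  - have /choice[S hS] : forall i, exists S, i < k -> [/\ definable A S, below N.+1 S,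
        G S & P i = fun x => S (upd es (x ord0))].
      by move=> i; case: (ltnP i k) => [/hP[S]|_]; [exists S|exists (fun=> True)].
    pose Q v := forall i, i < k -> S i v.
    have dQ : definable A Q by apply: definable_forall_lt => i /hS[].
    have bQ : below N.+1 Q.
      by move=> v v' h hv i ik; have [_ b _ _] := hS i ik; apply: b h (hv i ik).
    have GQ : G Q by apply: ultra_forall_lt => // i /hS[].
    (* Quantifying out [w0] gives a condition on the earlier variables alone, to which the invariant
       applies. *)
    have [u Qu] : exists u, Q (upd e u).
      apply: (ge (fun v => exists u, Q (upd v u))).
      + pose h (w : V) : V + unit := if w == w0 then inr tt else inl w.
        apply: definable_ext (definable_ex a0 (definable_rename h dQ)) => v.
        have hE f : copair v f \o h = upd v (f tt).
          by apply/funext => w; rewrite /= /h /upd; case: eqP.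
        by split=> [[f]|[u hu]]; [rewrite hE; exists (f tt)|exists (fun=> u); rewrite hE].
      + by move=> v v' h [u hu]; exists u; apply: updP hu.
      + apply: ultra_mono uG _ _ _ GQ => v Qv; exists (v w0).
        suff -> : upd v (v w0) = v by [].
        by apply/funext => w; rewrite /upd; case: eqP => // ->.
    exists (fun=> u) => i ik; have [_ _ _ ->] := hS i ik.
    by have := updP _ _ _ u bQ ees Qu; apply.
  exists (upd e (x ord0)); split.
    by move=> w wN; rewrite /upd; case: eqP => // ww0; rewrite ww0 w0N ltnn in wN.
  move=> S dS bS GS.
  have : S (upd es (x ord0)) by apply: (hx (fun y => S (upd es (y ord0)))); exists S.
  by apply: updP => // w /ees.
have /choice[nxt hnxt] : forall Ne : nat * (V -> U), exists e' : V -> U, good Ne.1 Ne.2 ->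
    (forall w, pickle w < Ne.1 -> e' w = Ne.2 w) /\ good Ne.1.+1 e'.
  move=> [N e]; have [/step[e' h]|] := pselect (good N e); first by exists e'.
  by exists e.
pose es := fix es N := if N is N'.+1 then nxt (N', es N') else (fun=> sval a0).
have ges N : good N (es N).
  by elim: N => // N IH; exact: (hnxt (N, es N) IH).2.
have esE N w : pickle w < N -> es N w = es (pickle w).+1 w.
  elim: N => // N IH; rewrite ltnS leq_eqVlt => /orP[/eqP <-//|wN].
  by rewrite -IH //; exact: (hnxt (N, es N) (ges N)).1.
exists (fun w => es (pickle w).+1 w) => S BS.
have [s hs] := definable_support (dB S BS).
have [N hN] : exists N, forall w, List.In w s -> pickle w < N.
  elim: (s) => [|w r [N hN]]; first by exists 0.
  exists (maxn N (pickle w).+1) => y [<-|/hN yN]; first by rewrite leq_max leqnn orbT.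
  by rewrite leq_max yN.
have bS : below N S by move=> e e' h; apply: hs => w /hN/h.
apply: bS (ges N S (dB S BS) bS (BG S BS)) => w; exact: esE.
Qed.

End Realization.

(** * Iterated ultrafilters *)

Definition scons (X : Type) (x : X) (e : nat -> X) (j : nat) : X :=
  if j is i.+1 then e i else x.

(** The layout of [gen (nseq n D)]: [n] generic entries, followed by the base sequence. *)
Definition splice (X : Type) (n : nat) (p e : nat -> X) (j : nat) : X :=
  if j < n then p j else e (j - n).

(* [gen [:: D_0; D_1; ...; D_l] A e] reads: for [D_l]-almost all [m_l], ..., for
   [D_0]-almost all [m_0], [A] holds of the sequence m_0, ..., m_l, e_0, e_1, ...
   When [D] is an ultrafilter on M, [gen (nseq n D)] is the type over M of a
   Morley sequence of length [n] in the global coheir defined by [D]. *)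
Fixpoint gen (X : Type) (l : seq ((X -> Prop) -> Prop)) (A : (nat -> X) -> Prop)
    (e : nat -> X) : Prop :=
  match l with
  | [::] => A e
  | D :: l' => gen l' (fun e' => D (fun m => A (scons m e'))) e
  end.

Section Gen.
Variable X : Type.
Implicit Types (D : (X -> Prop) -> Prop) (A : (nat -> X) -> Prop) (e p : nat -> X).

Lemma scons_splice n p e x : scons x (splice n p e) = splice n.+1 (scons x p) e.
Proof. by apply/funext => -[|j]. Qed.

Lemma splice0 p e : splice 0 p e = e.
Proof. by apply/funext => j; rewrite /splice /= subn0. Qed.

Lemma gen_cat l1 l2 A e : gen (l1 ++ l2) A e = gen l2 (gen l1 A) e.
Proof. by elim: l1 A => //= D l IH A; rewrite IH. Qed.

Lemma gen_ultra l e : List.Forall (@ultra X) l -> ultra (fun A => gen l A e).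
Proof.
elim=> {l} [|D l uD _ IH] /=; first by split=> // P Q PQ; exact: PQ.
split=> [P Q PQ|P Q hP hQ|P].
- by apply: (ultra_mono IH) => e'; apply: (ultra_mono uD) => m; apply: PQ.
- by apply: (ultra_mono2 IH _ hP hQ) => e'; apply: (ultra_and uD).
by rewrite -(ultra_not IH); split; apply: (ultra_mono IH) => e'; move/(ultra_not uD).
Qed.

Lemma gen_mono l A A' e : List.Forall (@ultra X) l ->
  (forall e', A e' -> A' e') -> gen l A e -> gen l A' e.
Proof. by move=> ul; apply: (ultra_mono (gen_ultra e ul)). Qed.

Lemma gen_mono2 l A1 A2 A' e : List.Forall (@ultra X) l ->
  (forall e', A1 e' -> A2 e' -> A' e') -> gen l A1 e -> gen l A2 e -> gen l A' e.
Proof. by move=> ul; apply: (ultra_mono2 (gen_ultra e ul)). Qed.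

Lemma Forall_nseq (T : Type) (P : T -> Prop) n x : P x -> List.Forall P (nseq n x).
Proof. by move=> Px; elim: n => //= n IH; constructor. Qed.

Lemma gen_nseq_ultra D n e : ultra D -> ultra (fun A => gen (nseq n D) A e).
Proof. by move=> uD; apply/gen_ultra/Forall_nseq. Qed.

Lemma gen_shift l e : List.Forall (@ultra X) l ->
  gen l (fun e' => forall j, e' (j + size l) = e j) e.
Proof.
elim=> {l} [|D l uD ul IH] /=; first by move=> j; rewrite addn0.
apply: (ultra_mono (gen_ultra e ul) _ IH) => e' h.
by apply: (ultra_true uD) => m j; rewrite addnS /= h.
Qed.

Lemma gen_points l e (P : X -> Prop) : List.Forall (@ultra X) l ->
  List.Forall (fun D => D P) l -> (forall j, P (e j)) ->
  gen l (fun e' => forall j, P (e' j)) e.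
Proof.
elim=> {l} [|D l uD ul IH] //= h Pe; inversion h; subst.
apply: (ultra_mono (gen_ultra e ul) _ (IH _ Pe)) => // e' he'.
by apply: (ultra_mono uD _ H1) => m Pm [|j] /=.
Qed.

Lemma gen_nseq_all D k e (P : X -> Prop) : ultra D -> D P ->
  gen (nseq k D) (fun e' => forall t, t < k -> P (e' t)) e.
Proof.
move=> uD DP; elim: k => [|k IH] //=.
apply: (ultra_mono (gen_nseq_ultra _ _ uD) _ IH) => e' h.
by apply: (ultra_mono uD _ DP) => m Pm [|j] //=; rewrite ltnS; apply: h.
Qed.

Lemma gen_base D n A A' e e' : ultra D ->
  (forall p, A (splice n p e) -> A' (splice n p e')) ->
  gen (nseq n D) A e -> gen (nseq n D) A' e'.
Proof.
move=> uD; elim: n A A' => [|n IH] A A' h /=.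
  by have := h e; rewrite !splice0.
apply: IH => p; apply: (ultra_mono uD) => m.
by rewrite !scons_splice; apply: h.
Qed.

(** An increasing subsequence of a Morley sequence is again one. In the induction on [N], the
    innermost generic either is the entry [g 0] of the subsequence or is not read at all. *)
Lemma gen_incr D N k (g : nat -> nat) A e0 e1 : ultra D ->
  (forall s t, s < t < k -> g s < g t) -> (forall t, t < k -> g t < N) ->
  gen (nseq k D) A e0 -> gen (nseq N D) (fun e => A (splice k (e \o g) e0)) e1.
Proof.
move=> uD; elim: N k g A => [|N IH] k g A ginc gN.
  by case: k {ginc} gN => [|k] gN; [rewrite /= splice0|have := gN 0 isT].
case: k ginc gN => [|k] ginc gN.
  move=> h; apply: (ultra_true (gen_nseq_ultra _ _ uD)) => e.
  by rewrite splice0.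
have [g0|g0] := posnP (g 0).
  pose g' t := (g t.+1).-1.
  have gS t : t < k -> g t.+1 = (g' t).+1.
    by move=> tk; rewrite prednK //; apply: leq_ltn_trans (ginc 0 t.+1 _).
  move=> /= /(IH k g') H.
  apply: (ultra_mono (gen_nseq_ultra _ _ uD) _ (H _ _)).
  - move=> e; apply: (ultra_mono uD) => m; rewrite scons_splice.
    suff -> : splice k.+1 (scons m (e \o g')) e0 = splice k.+1 (scons m e \o g) e0 by [].
    apply/funext => -[|j]; rewrite /splice /=; first by rewrite g0.
    by rewrite ltnS; case: ifP => // jk; rewrite gS.
  - move=> s t /andP[st tk]; rewrite -ltnS -!gS ?(ltn_trans st) //.
    by apply: ginc; rewrite !ltnS st.
  - by move=> t tk; rewrite -ltnS -gS // gN.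
pose g' t := (g t).-1.
have gS t : t < k.+1 -> g t = (g' t).+1.
  case: t => [|t] tk; first by rewrite prednK.
  by rewrite prednK //; apply: leq_ltn_trans (ginc 0 t.+1 _).
move=> /(IH k.+1 g') H; rewrite [nseq N.+1 _]/= /=.
apply: (ultra_mono (gen_nseq_ultra _ _ uD) _ (H _ _)).
- move=> e h; apply: (ultra_true uD) => m.
  suff -> : splice k.+1 (scons m e \o g) e0 = splice k.+1 (e \o g') e0 by [].
  by apply/funext => j; rewrite /splice /=; case: ifP => // jk; rewrite gS.
- move=> s t /andP[st tk]; rewrite -ltnS -!gS ?(ltn_trans st) //.
  by apply: ginc; rewrite st.
- by move=> t tk; rewrite -ltnS -gS // gN.
Qed.

End Gen.

(** Dividing witnessed by Morley sequences of the global coheir given by [D], stated through the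
    length [k] of an inconsistent initial segment. *)
Definition divides_along (Z X : Type) (D : (X -> Prop) -> Prop)
    (psi : Z -> X -> Prop) : Prop :=
  exists k, forall e, gen (nseq k D)
    (fun e' => ~ exists z, forall t, t < k -> psi z (e' t)) e.

Lemma not_divides_along (Z X : Type) (D : (X -> Prop) -> Prop)
    (psi : Z -> X -> Prop) (k : nat) (e : nat -> X) :
  ultra D -> ~ divides_along D psi ->
  gen (nseq k D) (fun e' => exists z, forall t, t < k -> psi z (e' t)) e.
Proof.
move=> uD nd; apply: contrapT => h; apply: nd; exists k => e'.
have := (ultra_not (gen_nseq_ultra k e uD) _).2 h.
apply: gen_base => // p np [z hz]; apply: np; exists z => t tk.
by have := hz t tk; rewrite /splice tk.
Qed.

(** * Coheirs *)

Lemma definable_coord (L : language) (U : structure L) (A : set U) (V W : Type)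
    (S : (W -> U) -> Prop) (F : (V -> U) -> W -> U) :
  (forall w, (exists x, forall v, F v w = v x) \/
             (exists2 u, A u & forall v, F v w = u)) ->
  definable A S -> definable A (fun v => S (F v)).
Proof.
move=> h dS.
have /choice[g hg] : forall w, exists y : V + {u | A u}, forall v, F v w = copair v sval y.
  move=> w; case: (h w) => [[x hx]|[u Au hu]]; first by exists (inl x).
  by exists (inr (exist _ u Au)).
apply: definable_ext (definable_subst g dS) => v.
by suff -> : copair v sval \o g = F v by []; apply/funext => w; rewrite hg.
Qed.

Section Coheir.
Variables (L : language) (U : structure L) (M : set U).
Variable V : Type.
Implicit Types (c : V -> U) (D : ((V -> U) -> Prop) -> Prop)
  (A : (nat -> V -> U) -> Prop) (e : nat -> V -> U).

(* The formulas true at [D]-almost all M-points form a global coheir of tp(c/M),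
   and every global coheir of tp(c/M) arises in this way. *)
Definition coheir c D : Prop :=
  [/\ ultra D, D (fun m => forall x, M (m x))
    & forall S, definable M S -> S c -> D S].

Definition seq_definable A : Prop :=
  definable M (fun v : nat * V -> U => A (fun i x => v (i, x))).

Lemma seq_definable_coord (W : Type) A (F : (W -> U) -> nat -> V -> U) :
  (forall i x, (exists w, forall v, F v i x = v w) \/
               (exists2 u, M u & forall v, F v i x = u)) ->
  seq_definable A -> definable M (fun v => A (F v)).
Proof.
move=> h dA; have := @definable_coord _ _ _ W _ _ (fun v ix => F v ix.1 ix.2) _ dA.
by apply=> -[i x]; apply: h.
Qed.

Lemma definable_slice A e : seq_definable A -> (forall i x, M (e i x)) ->
  definable M (fun m => A (scons m e)).
Proof.
move=> dA Me; apply: seq_definable_coord dA => -[|i] x; first by left; exists x.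
by right; exists (e i x).
Qed.

Lemma coheir_iff c D S : coheir c D -> definable M S -> D S <-> S c.
Proof.
move=> [uD _ h] dS; split=> [DS|]; last exact: h.
apply: contrapT => nS; have := h _ (definable_not dS) nS.
by move/(ultra_not uD).
Qed.

(** What is checked is the finite intersection property of three kinds of sets: definable sets
    containing [c], the set of [M]-points, and members of [B]. The first kind is closed under
    intersection, so a single [S] suffices. *)
Lemma coheir_exists c (B : ((V -> U) -> Prop) -> Prop) :
  (forall (S : (V -> U) -> Prop) N (P : nat -> (V -> U) -> Prop),
     definable M S -> S c -> (forall i, i < N -> B (P i)) ->
     exists m, [/\ forall x, M (m x), S m & forall i, i < N -> P i m]) ->
  exists2 D, coheir c D & forall P, B P -> D P.
Proof.
move=> h.
have [|D uD hD] := @ultra_fip _ (fun P => [\/ definable M P /\ P c,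
  P = (fun m => forall x, M (m x)) | B P]).
  move=> N P hP.
  have /choice[S hS] : forall i, exists S : (V -> U) -> Prop, [/\ definable M S, S c &
     i < N -> P i = S \/ (P i = (fun m => forall x, M (m x)) \/ B (P i))].
    move=> i; case: (ltnP i N) => [iN|]; last first.
      by exists (fun=> True); split=> //; exact: definable_const.
    case: (hP i iN) => [[dP Pc]|Pi|BP]; first by exists (P i); split=> //; left.
      by exists (fun=> True); split=> [|//|_]; [exact: definable_const|right; left].
    by exists (fun=> True); split=> [|//|_]; [exact: definable_const|right; right].
  pose js := [seq i <- iota 0 N | `[<B (P i)>]].
  have [||i|m [Mm Sm Pm]] := h (fun v => forall i, i < N -> S i v) (size js)
      (fun j => P (nth 0 js j)).
  - by apply: definable_forall_lt => i _; have [] := hS i.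
  - by move=> i _; have [] := hS i.
  - by move=> ijs; have := mem_nth 0 ijs; rewrite {2}/js mem_filter => /andP[/asboolP].
  exists m => i iN; have [_ _ /(_ iN)[->|[->|BP]]] := hS i => //; first exact: Sm.
  have ijs : i \in js by rewrite mem_filter mem_iota /= add0n iN andbT; apply/asboolP.
  by have := Pm (index i js); rewrite index_mem nth_index //; apply.
exists D; last by move=> P BP; apply: hD; apply: Or33.
split=> // [|S dS Sc]; apply: hD; by [apply: Or32|apply: Or31].
Qed.

End Coheir.

Lemma definable_eq (L : language) (U : structure L) (A : set U) (V : Type) (x y : V) :
  definable A (fun v : V -> U => v x = v y).
Proof. by exists (Equal (Var (inl x)) (Var (inl y))). Qed.

Section CoheirTheory.
Variables (L : language) (U : structure L) (M : set U).
Hypothesis elM : elementary_submodel M.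

Lemma elementary_sig : inhabited {u | M u}.
Proof. by have [u Mu] := elementary_point elM; constructor; exists u. Qed.

(** For [D]-almost all [w], some [v] in [S] restricts to [w], because [c] restricts to [c \o h]; by
    Tarski-Vaught [v] can be taken in [M]. Finiteness of [W] makes the restriction condition a
    single formula. *)
Lemma coheir_lift (V : Type) (W : finType) (h : W -> V) (c : V -> U)
    (D : ((W -> U) -> Prop) -> Prop) :
  coheir M (c \o h) D ->
  exists2 D', coheir M c D' & forall P, D P -> D' (fun v => P (v \o h)).
Proof.
move=> [uD DM cD].
have [|D' hD' hD] := @coheir_exists L U M V c
    (fun Q => exists2 P, D P & Q = fun v => P (v \o h)); last first.
  by exists D' => // P DP; apply: hD; exists P.
move=> S N Q dS Sc /= hQ.
have /choice[P hP] : forall i, exists P, i < N -> D P /\ Q i = fun v => P (v \o h).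
  by move=> i; case: (ltnP i N) => [/hQ[P]|_]; [exists P|exists (fun=> True)].
have [a0] := elementary_sig.
have DS : D (fun w => exists v, S v /\ forall x, v (h x) = w x).
  apply: cD; last by exists c.
  apply: (definable_ex a0 (S := fun f : W + V -> U =>
    S (f \o inr) /\ forall x, f (inr (h x)) = f (inl x))).
  apply: definable_and; first exact: definable_rename.
  by apply: definable_forall => x; apply: definable_eq.
have DP : D (fun w => forall i, i < N -> P i w).
  by apply: (ultra_forall_lt uD) => i /hP[].
have [w [[Mw [v [Sv vw]]] Pw]] := ultra_ex uD (ultra_and uD (ultra_and uD DM DS) DP).
have [|m Mm [Sm mw]] := @tarski_vaught _ _ _ elM _
  (fun v => S v /\ forall x, v (h x) = w x) _ (ex_intro _ v (conj Sv vw)).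
  apply: definable_and => //; apply: definable_forall => x.
  apply: (@definable_coord _ _ _ V bool (fun f => f true = f false)
    (fun v b => if b then v (h x) else w x)) => [[]|]; last exact: definable_eq.
    by left; exists (h x).
  by right; exists (w x).
exists m; split=> // i iN; rewrite (hP i iN).2.
by suff -> : m \o h = w by [apply: Pw]; apply/funext.
Qed.

Lemma coheir_transfer (V : Type) (c : V -> U) D D' (S : (V -> U) -> Prop) :
  coheir M c D -> coheir M c D' -> definable M S -> D S -> D' S.
Proof.
by move=> hD hD' dS /(coheir_iff hD dS) Sc; apply/(coheir_iff hD' dS).
Qed.

Definition definable2 (Z V : Type) (psi : (Z -> U) -> (V -> U) -> Prop) : Prop :=
  definable M (fun v : Z + V -> U => psi (v \o inl) (v \o inr)).

Lemma definable2_coord (W Z V : Type) (psi : (Z -> U) -> (V -> U) -> Prop)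
    (F : (W -> U) -> Z -> U) (G : (W -> U) -> V -> U) :
  (forall z, (exists x, forall v, F v z = v x) \/
             (exists2 u, M u & forall v, F v z = u)) ->
  (forall z, (exists x, forall v, G v z = v x) \/
             (exists2 u, M u & forall v, G v z = u)) ->
  definable2 psi -> definable M (fun v => psi (F v) (G v)).
Proof.
move=> hF hG.
have := @definable_coord _ _ M W (Z + V) (fun v => psi (v \o inl) (v \o inr))
  (fun v => copair (F v) (G v)).
by apply=> -[z|y] /=; [apply: hF|apply: hG].
Qed.

Lemma seq_definable_inconsistent (Z V : Type) (psi : (Z -> U) -> (V -> U) -> Prop)
    (k : nat) : definable2 psi ->
  seq_definable M (fun e => exists z, forall t, t < k -> psi z (e t)).
Proof.
move=> dpsi; have [a0] := elementary_sig.
apply: (definable_ex a0 (S := fun f : nat * V + Z -> U =>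
  forall t, t < k -> psi (f \o inr) (fun x => f (inl (t, x))))).
apply: definable_forall_lt => t _; apply: definable2_coord dpsi => [z|x]; left.
  by exists (inr z).
by exists (inl (t, x)).
Qed.

(** * The broom lemma *)

Section Broom.
Variables (V : Type) (c : V -> U) (b : U -> U) (N : nat).
Variables (psi : nat -> (U -> U) -> (V -> U) -> Prop).
Variables (DD : nat -> ((V -> U) -> Prop) -> Prop) (kk : nat -> nat).
Hypothesis dpsi : forall i, i < N -> definable2 (psi i).
Hypothesis cDD : forall i, i < N -> coheir M c (DD i).
Hypothesis hkk : forall i, i < N -> forall e, gen (nseq (kk i) (DD i))
  (fun e' => ~ exists z, forall t, t < kk i -> psi i z (e' t)) e.

Fixpoint some_holds (l : seq nat) (e : nat -> V -> U) : Prop :=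
  if l is n :: l' then
    (exists2 i, i < n & psi i b (e 0)) \/ some_holds l' (fun j => e j.+1)
  else False.

(* With m_0, m_1, ... generic as prescribed by [l], some M-definable condition on
   them implies that [b] satisfies the disjunction of the formulas
   psi_i(z, m_j), i < n_j, where n_j is the second component of the j-th entry. *)
Definition bad (e0 : nat -> V -> U) (l : seq ((((V -> U) -> Prop) -> Prop) * nat)) :
    Prop :=
  exists A, [/\ seq_definable M A, gen (map fst l) A e0
    & forall e, (forall j x, M (e j x)) -> A e -> some_holds (map snd l) e].

Variable e0 : nat -> V -> U.
Hypothesis Me0 : forall j x, M (e0 j x).

Lemma some_holds_nseq (k n : nat) (l : seq nat) (e : nat -> V -> U) :
  (exists2 t, t < k & exists2 i, i < n & psi i b (e t)) \/
    some_holds l (fun j => e (j + k)) ->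
  some_holds (nseq k n ++ l) e.
Proof.
elim: k e => [|k IH] e /=.
  case=> [[]//|]; suff -> : (fun j => e (j + 0)) = e by [].
  by apply/funext => j; rewrite addn0.
case=> [[[|t] tk [i iN h]]|h].
- by left; exists i.
- by right; apply: IH; left; exists t => //; exists i.
- right; apply: IH; right; move: h.
  suff -> : (fun j => e (j + k.+1)) = (fun j => e (j + k).+1) by [].
  by apply/funext => j; rewrite addnS.
Qed.

(* The disjunction attached to the first variable is removed: its last formula
   [psi_n] disappears when the variable is replaced by [kk n] generics of the
   coheir along which [psi_n] divides, leaving only [psi_i] with [i < n]. *)
Lemma bad_cons (n : nat) D l : n <= N -> coheir M c D ->
  List.Forall (fun Dn => coheir M c Dn.1) l ->
  bad e0 ((D, n) :: l) -> bad e0 l.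
Proof.
have [a0] := elementary_sig.
have ul (l' : seq (_ * nat)) : List.Forall (fun Dn => coheir M c Dn.1) l' ->
    List.Forall (@ultra (V -> U)) (map fst l').
  by elim=> //= Dn l1 [u _ _] _ IH; constructor.
have pl (l' : seq (_ * nat)) : List.Forall (fun Dn => coheir M c Dn.1) l' ->
    List.Forall (fun D => D (fun m : V -> U => forall x, M (m x))) (map fst l').
  by elim=> //= Dn l1 [_ u _] _ IH; constructor.
elim: n D l => [|n IH] D l nN cD cl [A [dA /= gA hA]].
  (* For [n = 0] the first disjunction is empty: the variable is quantified out, and its witness is
     moved into [M]. *)
  exists (fun e => exists m, A (scons m e)); split.
  - apply: (definable_ex a0 (S := fun f : nat * V + V -> U =>
      A (scons (f \o inr) (fun i x => f (inl (i, x)))))).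
    apply: seq_definable_coord dA => -[|i] x; left; first by exists (inr x).
    by exists (inl (i, x)).
  - apply: (gen_mono (ul _ cl) _ gA) => e.
    by case: cD => uD _ _ /(ultra_ex uD).
  - move=> e Me [m Am].
    have [m' Mm' Am'] := tarski_vaught elM (definable_slice dA Me) (ex_intro _ m Am).
    have Msc j x : M (scons m' e j x) by case: j => [|j]; [apply: Mm'|apply: Me].
    by have [[]|] := hA _ Msc Am'.
have cDn := cDD nN.
(* Each of the [kk n] new entries carries only [n] formulas, so the induction hypothesis removes
   them one by one. *)
suff bk : bad e0 (nseq (kk n) (DD n, n) ++ l).
  elim: (kk n) bk => //= j IHj bj; apply: IHj; apply: (IH _ _ (ltnW nN) cDn _ bj).
  by elim: (j) => //= i; constructor.
(* Every new generic can replace the old first variable, and [psi n] is inconsistent along them. If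
   [b] failed all the other disjuncts, it would satisfy [psi n] at all of them. *)
exists (fun e => (forall t, t < kk n -> A (scons (e t) (fun j => e (j + kk n)))) /\
  ~ exists z, forall t, t < kk n -> psi n z (e t)); split.
- apply: definable_and; last first.
    exact: definable_not (seq_definable_inconsistent (kk n) (dpsi nN)).
  apply: definable_forall_lt => t _; apply: seq_definable_coord dA => -[|i] x; left.
    by exists (t, x).
  by exists (i + kk n, x).
- rewrite map_cat map_nseq gen_cat.
  apply: (gen_mono2 (ul _ cl) _ gA (gen_points (ul _ cl) (pl _ cl) Me0)) => e gAe Me.
  have [uDn _ _] := cDn.
  have uG := gen_nseq_ultra (kk n) e uDn.
  have g1 := coheir_transfer cD cDn (definable_slice dA Me) gAe.
  have g2 := gen_shift e (Forall_nseq (kk n) uDn).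
  apply: (ultra_and uG); last exact: hkk.
  apply: (gen_mono2 (Forall_nseq _ uDn) _ (gen_nseq_all (kk n) e uDn g1) g2) => e' h1 h2 t tk.
  suff -> : (fun j => e' (j + kk n)) = e by apply: h1.
  by apply/funext => j; rewrite -h2 size_nseq.
- move=> e Me [h1 h2]; rewrite map_cat map_nseq; apply: some_holds_nseq.
  apply: contrapT => nh; apply: h2; exists b => t tk.
  have Msc j x : M (scons (e t) (fun j => e (j + kk n)) j x) by case: j => [|j]; apply: Me.
  have [[i]|h] := hA _ Msc (h1 t tk).
    rewrite ltnS leq_eqVlt => /orP[/eqP->//|iN h]; case: nh; left.
    by exists t => //; exists i.
  by case: nh; right.
Qed.

(** If no such [m] existed, [S] would make a one-entry list bad; removing that entry leaves the
    empty list, whose disjunction is [False], implied by a condition true of [e0]. *)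
Lemma broom (S : (V -> U) -> Prop) : definable M S -> S c -> 0 < N ->
  exists m, [/\ forall x, M (m x), S m & forall i, i < N -> ~ psi i b m].
Proof.
move=> dS Sc N0; apply: contrapT => nm.
suff : bad e0 [:: (DD 0, N)].
  move/(bad_cons (leqnn N) (cDD N0) (List.Forall_nil _)) => [A [_ A0 hA]].
  by have := hA _ Me0 A0.
have [uD DM cD] := cDD N0.
exists (fun e => S (e 0)); split=> /=.
- by apply: (definable_rename (fun x => (0, x)) dS).
- exact: cD.
- move=> e Me Se; left; apply: contrapT => ni; apply: nm; exists (e 0); split=> // i iN h.
  by apply: ni; exists i.
Qed.

End Broom.

(* The witness required by Kim's lemma: a realization of the coheir [R] over
   M and a tuple [b] leaves tp(b/M) non-dividing along every coheir of tp(c/M). *)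
Lemma strict_coheir (V : Type) (c : V -> U) :
  exists2 R, coheir M c R & forall (Z : Type) (psi : (Z -> U) -> (V -> U) -> Prop) b D,
    definable2 psi -> R (psi b) -> coheir M c D -> ~ divides_along D psi.
Proof.
have [u0 Mu0] := elementary_point elM.
(* It is enough to treat [b = id], the enumeration of [U] by itself; any other tuple [b] is absorbed
   by composing inside [psi]. *)
have [|R cR hR] := @coheir_exists L U M V c
  (fun P => exists psi : (U -> U) -> (V -> U) -> Prop, exists D,
    [/\ definable2 psi, coheir M c D, divides_along D psi
      & P = fun m => ~ psi id m]); last first.
  exists R => // Z psi b D dpsi Rpsi cD [k hk].
  have [uR _ _] := cR.
  suff /(ultra_not uR) : R (fun m => ~ psi b m) by apply.
  apply: hR; exists (fun f m => psi (f \o b) m), D; split=> //.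
    apply: definable2_coord dpsi => z; left; first by exists (inl (b z)).
    by exists (inr z).
  exists k => e; have [uD _ _] := cD.
  apply: (gen_mono (Forall_nseq _ uD) _ (hk e)) => e' h [z hz]; apply: h.
  by exists (z \o b).
move=> S [|N] P dS Sc hP.
  by have [m Mm Sm] := tarski_vaught elM dS (ex_intro _ c Sc); exists m.
have /choice[psi hpsi] : forall i, exists psi : (U -> U) -> (V -> U) -> Prop, i < N.+1 ->
    exists D, [/\ definable2 psi, coheir M c D, divides_along D psi
      & P i = fun m => ~ psi id m].
  by move=> i; case: (ltnP i N.+1) => [/hP[psi h]|_]; [exists psi|exists (fun _ _ => True)].
have /choice[D hD] : forall i, exists D, i < N.+1 -> [/\ definable2 (psi i), coheir M c D,
    divides_along D (psi i) & P i = fun m => ~ psi i id m].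
  by move=> i; case: (ltnP i N.+1) => [/hpsi[D h]|_]; [exists D|exists (fun=> True)].
have /choice[kk hkk] : forall i, exists k, i < N.+1 -> forall e, gen (nseq k (D i))
    (fun e' => ~ exists z, forall t, t < k -> psi i z (e' t)) e.
  by move=> i; case: (ltnP i N.+1) => [/hD[_ _ [k hk] _]|_]; [exists k|exists 0].
have [||//|m [Mm Sm hm]] :=
  @broom V c id N.+1 psi D kk _ _ hkk (fun _ _ => u0) _ S dS Sc (ltn0Sn N).
- by move=> i /hD[].
- by move=> i /hD[].
by exists m; split=> // i iN; have [_ _ _ ->] := hD i iN; apply: hm.
Qed.

End CoheirTheory.

(** * Finite increasing sequences, pigeonhole, and rows of arrays *)

Definition increasing_below (k : nat) (g : nat -> nat) : Prop :=
  forall s t, s < t < k -> g s < g t.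

Lemma increasing_id (k : nat) : increasing_below k id.
Proof. by move=> s t /andP[]. Qed.

(** Pigeonhole: among the first [J * #|F|] indices some colour occurs at least [J] times, and [g]
    lists these occurrences in order. *)
Lemma monochromatic_subsequence (F : finType) (col : nat -> F) (J : nat) :
  exists g, [/\ increasing_below J g, forall t, t < J -> g t < J * #|F|
    & exists f, forall t, t < J -> col (g t) = f].
Proof.
pose js f := [seq i <- iota 0 (J * #|F|) | col i == f].
have sumE (s : seq nat) : \sum_(f : F) size [seq i <- s | col i == f] = size s.
  elim: s => [|i s IH]; first by rewrite big1.
  have -> : \sum_(f : F) size [seq j <- i :: s | col j == f] =
      \sum_(f : F) ((col i == f) + size [seq j <- s | col j == f]).
    by apply: eq_bigr => f _ /=; case: eqP.
  rewrite big_split /= (bigD1 (col i)) //= eqxx big1 ?IH // => f.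
  by rewrite eq_sym => /negbTE ->.
have [f Jf] : exists f, J <= size (js f).
  apply: contrapT => nf.
  have F0 : 0 < #|F| by apply/card_gt0P; exists (col 0).
  have J0 : 0 < J by rewrite lt0n; apply/eqP => J0; apply: nf; exists (col 0); rewrite J0.
  have : \sum_(f : F) size (js f) <= \sum_(f : F) J.-1.
    apply: leq_sum => f _; rewrite -ltnS prednK // ltnNge; apply/negP => h.
    by apply: nf; exists f.
  rewrite sumE size_iota sum_nat_const mulnC leq_pmul2l //.
  by rewrite leqNgt ltn_predL J0.
have jsf t : t < J -> nth 0 (js f) t \in js f.
  by move=> tJ; apply: mem_nth; apply: leq_trans Jf.
exists (nth 0 (js f)); split.
- move=> s t /andP[st tJ]; apply: (sorted_ltn_nth ltn_trans) => //.
  + exact: (sorted_filter ltn_trans _ (iota_ltn_sorted _ _)).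
  + by rewrite inE (leq_trans _ Jf) // (ltn_trans st).
  + by rewrite inE (leq_trans _ Jf).
- by move=> t /jsf; rewrite mem_filter mem_iota => /andP[_].
- by exists f => t /jsf; rewrite mem_filter => /andP[/eqP].
Qed.

(** Bridge between the injections in [k_inconsistent] and the increasing sequences that describe
    rows: the values are sorted. *)
Lemma increasing_injective (k : nat) (i : 'I_k -> nat) : injective i ->
  exists2 g, increasing_below k g & forall t, t < k -> exists t', g t = i t'.
Proof.
move=> inj_i; pose js := sort leq [seq i t | t <- enum 'I_k].
have sz : size js = k by rewrite size_sort size_map size_enum_ord.
exists (nth 0 js) => [s t /andP[st tk]|t tk].
  apply: (sorted_ltn_nth ltn_trans) => //; rewrite ?inE ?sz //.
    rewrite ltn_sorted_uniq_leq sort_uniq map_inj_uniq ?enum_uniq //=.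
    by apply: sort_sorted leq_total _.
  exact: ltn_trans tk.
have : nth 0 js t \in js by apply: mem_nth; rewrite sz.
by rewrite mem_sort => /mapP[t' _ ->]; exists t'.
Qed.

(** Turns quantification over [g] into a finite conjunction, which both definability and
    ultrafilters respect. *)
Lemma increasing_finite (k J : nat) : exists (I : finType) (ext : I -> nat -> nat),
  (forall i, increasing_below k (ext i) /\ forall t, t < k -> ext i t < J) /\
  forall g, increasing_below k g -> (forall t, t < k -> g t < J) ->
    exists i, forall t, t < k -> ext i t = g t.
Proof.
pose ext (f : {ffun 'I_k -> 'I_J}) (t : nat) := if insub t is Some t' then val (f t') else 0.
exists {f : {ffun 'I_k -> 'I_J} | `[<increasing_below k (ext f)>]}, (fun f => ext (val f)).
split=> [[f /= /asboolP hf]|g ginc gJ].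
  by split=> // t tk; rewrite /ext; case: insubP => [t' _ _|]; [apply: ltn_ord|rewrite tk].
pose f := [ffun t : 'I_k => Ordinal (gJ t (ltn_ord t))].
have fE t : t < k -> ext f t = g t.
  move=> tk; rewrite /ext; case: insubP => [t' _ tt'|]; last by rewrite tk.
  by rewrite ffunE -tt'.
have hf : `[<increasing_below k (ext f)>].
  apply/asboolP => s t /andP[st tk]; rewrite !fE //; last exact: ltn_trans tk.
  by apply: ginc; rewrite st.
by exists (exist _ f hf).
Qed.

Definition inconsistent_row (Z X : Type) (psi : Z -> X -> Prop) (k J : nat)
    (e : nat -> X) : Prop :=
  forall g, increasing_below k g -> (forall t, t < k -> g t < J) ->
    ~ exists x, forall t, t < k -> psi x (e (g t)).

Lemma inconsistent_row_finite (Z X : Type) (psi : Z -> X -> Prop) (k J : nat) :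
  exists (I : finType) (ext : I -> nat -> nat),
  (forall i, increasing_below k (ext i) /\ forall t, t < k -> ext i t < J) /\
  forall e, inconsistent_row psi k J e <->
    forall i, ~ exists x, forall t, t < k -> psi x (e (ext i t)).
Proof.
have [I [ext [h1 h2]]] := increasing_finite k J.
exists I, ext; split=> // e; split=> [h i|h g ginc gJ [x hx]].
  by apply: h; have [] := h1 i.
have [i hi] := h2 g ginc gJ; apply: (h i); exists x => t tk; rewrite hi //; exact: hx.
Qed.

Lemma ultra_inconsistent_row (Z X Y : Type) (D : (Y -> Prop) -> Prop)
    (psi : Z -> X -> Prop) (k J : nat) (F : Y -> nat -> X) : ultra D ->
  (forall g, increasing_below k g -> (forall t, t < k -> g t < J) ->
    D (fun y => ~ exists x, forall t, t < k -> psi x (F y (g t)))) ->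
  D (fun y => inconsistent_row psi k J (F y)).
Proof.
move=> uD h; have [I [ext [h1 h2]]] := inconsistent_row_finite psi k J.
apply: (ultra_mono uD (fun y => (h2 (F y)).2)).
by apply: (ultra_forall uD) => i; apply: h; have [] := h1 i.
Qed.

Lemma inconsistent_row_definable (L : language) (U : structure L) (M : set U)
    (Z V : Type) (psi : (Z -> U) -> (V -> U) -> Prop) (k J : nat) :
  elementary_submodel M -> definable2 M psi ->
  seq_definable M (inconsistent_row psi k J).
Proof.
move=> elM dpsi; have [I [ext [h1 h2]]] := inconsistent_row_finite psi k J.
apply: definable_ext (fun v => iff_sym (h2 _)) _.
apply: definable_forall => i; apply: definable_not.
apply: (seq_definable_coord (A := fun e => exists x, forall t, t < k -> psi x (e t))
    (F := fun v t x => v (ext i t, x))).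
  by move=> t x; left; eexists; reflexivity.
exact: seq_definable_inconsistent.
Qed.

Lemma uniform_bound (N : nat) (P : nat -> nat -> Prop) :
  (forall i, i < N -> exists J, forall J', J <= J' -> P i J') ->
  exists J, forall i, i < N -> forall J', J <= J' -> P i J'.
Proof.
elim: N => [|N IH] h; first by exists 0.
have [|J1 h1] := IH; first by move=> i iN; apply: h; apply: ltnW.
have [J2 h2] := h N (ltnSn N).
exists (maxn J1 J2) => i.
rewrite ltnS leq_eqVlt => /orP[/eqP ->|iN] J'; rewrite geq_max => /andP[a1 a2].
  exact: h2.
exact: h1.
Qed.

(** * Finite conjunctions of formulas of a partial type *)

Section FinitePart.
Variables (L : language) (U : structure L) (n : nat).
Implicit Types (p q : set (pformula U n)) (theta : ('I_n -> U) -> Prop).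

Definition finite_part p theta : Prop :=
  exists q, [/\ finite_set q, q `<=` p & theta = realizes q].

Lemma finite_part_true p : finite_part p (fun=> True).
Proof.
by exists set0; split=> //; apply/funext => x; apply/propext; split=> // _ psi.
Qed.

Lemma finite_part1 p psi : p psi -> finite_part p (psat psi).
Proof.
move=> ppsi; exists [set psi]; split=> [//|_ ->//|].
by apply/funext => x; apply/propext; split=> [h _ ->//|]; apply.
Qed.

Lemma finite_part_and p t1 t2 :
  finite_part p t1 -> finite_part p t2 -> finite_part p (fun x => t1 x /\ t2 x).
Proof.
move=> [q1 [f1 s1 ->]] [q2 [f2 s2 ->]]; exists (q1 `|` q2); split.
- by rewrite finite_setU.
- by move=> psi [/s1|/s2].
- apply/funext => x; apply/propext; split=> [[h1 h2] psi [/h1|/h2]//|h].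
  by split=> psi hpsi; apply: h; [left|right].
Qed.

Lemma finite_part_forall p (N : nat) (t : nat -> ('I_n -> U) -> Prop) :
  (forall i, i < N -> finite_part p (t i)) ->
  finite_part p (fun x => forall i, i < N -> t i x).
Proof.
elim: N => [|N IH] h.
  suff -> : (fun x => forall i, i < 0 -> t i x) = fun=> True by apply: finite_part_true.
  by apply/funext => x; apply/propext.
have := finite_part_and (IH (fun i iN => h i (ltnW iN))) (h N (ltnSn N)).
suff -> : (fun x => (forall i, i < N -> t i x) /\ t N x) =
  fun x => forall i, i < N.+1 -> t i x by [].
apply/funext => x; apply/propext; split=> [[h1 h2] i|h1].
  by rewrite ltnS leq_eqVlt => /orP[/eqP->//|/h1].
by split=> [i iN|]; apply: h1 => //; apply: ltnW.
Qed.

Lemma finite_part_definable (M : set U) p theta : p `<=` formula_over M ->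
  finite_part p theta -> definable M theta.
Proof.
move=> pM [q [/(@finite_seqP {classic (pformula U n)})[s ->] sp ->]].
apply: (@definable_forall_seq _ _ _ _ {classic (pformula U n)}) => psi ps.
exact: pformula_definable (pM _ (sp _ ps)).
Qed.

Lemma finite_subset_range p (psi : nat -> pformula U n) q :
  finite_set q -> q `<=` range psi `|` p ->
  exists (N : nat) theta, finite_part p theta /\
    forall x, theta x -> (forall i, i < N -> psat (psi i) x) -> realizes q x.
Proof.
move=> /(@finite_seqP {classic (pformula U n)})[s ->]; elim: s => [|chi s IH] sp.
  by exists 0, (fun=> True); split=> //; apply: finite_part_true.
have [|N [theta [pt h]]] := IH.
  by move=> psi' hpsi; apply: sp; rewrite /= inE; apply/orP; right.
have [[i _ ie]|pchi] : (range psi `|` p) chi by apply: sp; exact: mem_head.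
  exists (maxn N i.+1), theta; split=> // x tx hx chi' /=; rewrite inE => /orP[/eqP->|].
    by rewrite -ie; apply: hx; rewrite leq_max leqnn orbT.
  by apply: h => // j jN; apply: hx; rewrite leq_max jN.
exists N, (fun x => theta x /\ psat chi x); split.
  exact: finite_part_and (finite_part1 pchi).
move=> x [tx cx] hx chi' /=; rewrite inE => /orP[/eqP->//|]; exact: h.
Qed.

End FinitePart.

(** * From finite arrays to a violation of NTP2 *)

Section NTP2Array.
Variables (K : Type) (L : language) (U : structure L) (M : set U).
Hypothesis satU : saturated K U.
Hypothesis elM : elementary_submodel M.
Hypothesis smallM : forall F, finite_set F -> smaller_than K (M `|` F).
Variables (n : nat) (p : set (pformula U n)) (V : finType).
Hypothesis pM : p `<=` formula_over M.
Hypothesis ntp : NTP2 p.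

(** Compactness: finite arrays of every size, with paths consistent with every finite part of [p],
    would be glued by saturation into an infinite array contradicting NTP2. *)
Lemma ntp2_array (psi : ('I_n -> U) -> (V -> U) -> Prop) (k : nat) :
  definable2 M psi ->
  ~ (forall J theta, 0 < J -> finite_part p theta ->
     exists b : nat -> nat -> V -> U,
       (forall al, al < J -> inconsistent_row psi k J (b al)) /\
       (forall f, (forall al, f al < J) ->
          exists x, theta x /\ forall al, al < J -> psi x (b al (f al)))).
Proof.
move=> dpsi arr; apply: ntp.
have [a0] := elementary_sig elM.
pose row (v : (nat * nat * V)%type -> U) al i : V -> U := fun x => v (al, i, x).
have rowc al i x : exists y, forall v : (nat * nat * V)%type -> U, row v al i x = v y.
  by exists (al, i, x).
have [|N P hP|e he] := @realize_countable K L U satU M a0 (nat * nat * V)%type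
   (fun S => (exists al g, increasing_below k g /\
      S = fun v => ~ exists x, forall t, t < k -> psi x (row v al (g t))) \/
     (exists theta N f, finite_part p theta /\
      S = fun v => exists x, theta x /\ forall al, al < N -> psi x (row v al (f al)))) smallM.
- move=> S [[al [g [_ ->]]]|[theta [N [f [pt ->]]]]].
    apply: (@definable_not _ _ _ _
      (fun v => exists x, forall t, t < k -> psi x (row v al (g t)))).
    apply: (definable_ex a0 (S := fun v : (nat * nat * V) + 'I_n -> U =>
      forall t, t < k -> psi (v \o inr) (row (v \o inl) al (g t)))).
    apply: definable_forall_lt => t _; apply: definable2_coord dpsi => y; left.
      by exists (inr y).
    by exists (inl (al, g t, y)).
  apply: (definable_ex a0 (S := fun v : (nat * nat * V) + 'I_n -> U =>
    theta (v \o inr) /\ forall al, al < N -> psi (v \o inr) (row (v \o inl) al (f al)))).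
  apply: definable_and; first exact: definable_rename (finite_part_definable pM pt).
  apply: definable_forall_lt => t _; apply: definable2_coord dpsi => y; left.
    by exists (inr y).
  by exists (inl (t, f t, y)).
- pose isarr J theta (b : nat -> nat -> V -> U) :=
       (forall al, al < J -> inconsistent_row psi k J (b al)) /\
       (forall f, (forall al, f al < J) ->
          exists x, theta x /\ forall al, al < J -> psi x (b al (f al))).
  have /choice[theta htheta] : forall i, exists theta : ('I_n -> U) -> Prop,
      finite_part p theta /\ (i < N -> exists J, forall J', J <= J' -> 0 < J' ->
      forall (theta' : ('I_n -> U) -> Prop) b,
        (forall x, theta' x -> theta x) -> isarr J' theta' b ->
        P i (fun y => b y.1.1 y.1.2 y.2)).
    move=> i; case: (ltnP i N) => [iN|_]; last first.
      by exists (fun=> True); split=> //; apply: finite_part_true.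
    have [[al [g [ginc ->]]]|[theta [N' [f [pt ->]]]]] := hP i iN.
      exists (fun=> True); split=> [|_]; first exact: finite_part_true.
      exists (maxn al.+1 (\max_(t < k) (g t).+1)) => J'.
      rewrite geq_max => /andP[alJ gJ] _ theta' b _ [rows _]; apply: rows => // t tk.
      by apply: leq_trans gJ; apply: (leq_bigmax_cond (Ordinal tk)).
    exists theta; split=> // _.
    exists (maxn N' (\max_(t < N') (f t).+1)) => J'.
    rewrite geq_max => /andP[NJ fJ] J0 theta' b tt' [_ paths].
    (* Paths through the finite array must stay below [J'] in every row; [f] does so in the rows
       that count and is reset to 0 where it does not. *)
    have [al|x [tx hx]] := paths (fun al => if f al < J' then f al else 0).
      by case: ifP.
    exists x; split=> [|al alN]; first exact: tt'.
    have := hx al (leq_trans alN NJ); rewrite ifT //.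
    by apply: leq_trans fJ; apply: (leq_bigmax_cond (Ordinal alN)).
  have [J hJ] := uniform_bound (fun i iN => (htheta i).2 iN).
  have pt := finite_part_forall (fun i (_ : i < N) => (htheta i).1).
  have [b hb] := arr J.+1 _ (ltn0Sn J) pt.
  exists (fun y => b y.1.1 y.1.2 y.2) => i iN.
  apply: (hJ i iN J.+1 (leqnSn J) (ltn0Sn J) _ b _ hb) => x; exact.
have [l [phi [h hphi]]] := definable_split a0 dpsi.
exists l, (fun al i => copair (row e al i) sval \o h), phi, k; split.
- move=> al i inj_i cons.
  have [g ginc gi] := increasing_injective inj_i.
  have [|//|x hx] := cons (range (fun t => PFormula phi (copair (row e al (i t)) sval \o h))).
    exact: finite_image.
  have := he _ (or_introl (ex_intro _ al (ex_intro _ g (conj ginc erefl)))); apply.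
  exists x => t tk; have [t' ->] := gi t tk.
  by have := hx _ (ex_intro2 _ _ t' I erefl); rewrite /psat /= -hphi.
- move=> f q fq sq; have [N [theta [pt ht]]] := finite_subset_range fq sq.
  have [x [tx hx]] := he _ (or_intror
    (ex_intro _ theta (ex_intro _ N (ex_intro _ f (conj pt erefl))))).
  exists x; apply: ht => // al alN.
  by have := hx al alN; rewrite /psat /= -hphi.
Qed.

End NTP2Array.

(** When all projections of [E] contain [D], reading one coordinate of each term of an [E]-generic
    sequence gives a [D]-generic sequence, whichever coordinates [f] selects. *)
Lemma gen_path (X Y : Type) (D : (X -> Prop) -> Prop) (E : (Y -> Prop) -> Prop)
    (proj : nat -> Y -> X) (n : nat) (f : nat -> nat) (A : (nat -> X) -> Prop) e0 e1 :
  ultra D -> ultra E -> (forall P i, D P -> E (fun y => P (proj i y))) ->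
  gen (nseq n D) A e0 ->
  gen (nseq n E) (fun e => A (splice n (fun al => proj (f al) (e al)) e0)) e1.
Proof.
move=> uD uE DE; elim: n f A => [|n IH] f A /=; first by rewrite splice0.
move=> /(IH (fun i => f i.+1)); apply: gen_mono; first exact: Forall_nseq.
move=> e /(DE _ (f 0)); apply: (ultra_mono uE) => y; rewrite scons_splice.
suff -> : scons (proj (f 0) y) (fun al => proj (f al.+1) (e al)) =
  fun al => proj (f al) (scons y e al) by [].
by apply/funext => -[].
Qed.

(** * Dividing over a model is witnessed by coheirs *)

Section Dividing.
Variables (K : Type) (L : language) (U : structure L) (M : set U).
Hypothesis satU : saturated K U.
Hypothesis elM : elementary_submodel M.
Hypothesis smallM : forall F, finite_set F -> smaller_than K (M `|` F).

Lemma indiscernible_transfer (m : nat) (s : nat -> 'I_m -> U) A J g g' :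
  indiscernible M s -> seq_definable M A ->
  (forall e e' : nat -> 'I_m -> U, (forall j, j < J -> e j = e' j) -> A e -> A e') ->
  increasing_below J g -> increasing_below J g' -> A (s \o g) -> A (s \o g').
Proof.
move=> ind dA hA hg hg' Ag; have [a0] := elementary_sig elM.
pose S (v : 'I_J * 'I_m + void -> U) := A (fun i x =>
  if insub i is Some i' then v (inl (i', x)) else sval a0).
have dS : definable M S.
  apply: (seq_definable_coord (F := fun v i x =>
    if insub i is Some i' then v (inl (i', x)) else sval a0)) dA => i x.
  case: insubP => [i' _ _|_]; first by left; exists (inl (i', x)).
  by right; exists (sval a0) => //; apply: svalP.
have SA k : S (copair (fun tr => s (k (val tr.1)) tr.2) (of_void U)) <-> A (s \o k).
  split; apply: hA => j jJ; apply/funext => x /=.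
    by case: insubP => [i' _ <-|] //; rewrite jJ.
  by case: insubP => [i' _ <-|] //; rewrite jJ.
have [l [phi [h hphi]]] := definable_split a0 dS.
have := ind J l phi (copair (of_void U) sval \o h) (g \o val) (g' \o val).
case=> [t|t t' tt'|t t' tt'|].
- by rewrite /=; case: (h t) => [[]|a]; apply: svalP.
- by apply: hg; rewrite tt' /=.
- by apply: hg'; rewrite tt' /=.
move=> H _; apply/SA/hphi.
move/SA/hphi: Ag => {}/H; exact.
Qed.

(* Monochromatic subsequences, found by the pigeonhole principle in long enough
   M-valued approximations of [s], make all coordinates of [E] push [E] forward
   to the same ultrafilter. *)
Lemma indiscernible_coheir (m : nat) (s : nat -> 'I_m -> U) : indiscernible M s ->
  exists2 E, coheir M (fun ix : nat * 'I_m => s ix.1 ix.2) E &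
    forall (Y : ('I_m -> U) -> Prop) i j,
      E (fun v => Y (fun x => v (i, x)) <-> Y (fun x => v (j, x))).
Proof.
move=> ind; have [a0] := elementary_sig elM.
have [|E cE hE] := @coheir_exists L U M (nat * 'I_m)%type (fun ix => s ix.1 ix.2)
  (fun Q => exists (Y : ('I_m -> U) -> Prop) i j,
    Q = fun v => Y (fun x => v (i, x)) <-> Y (fun x => v (j, x))); last first.
  by exists E => // Y i j; apply: hE; exists Y, i, j.
move=> S N P dS Ss hP.
have /choice[Y hY] : forall i, exists Y : ('I_m -> U) -> Prop, i < N -> exists i1 i2,
    P i = fun v => Y (fun x => v (i1, x)) <-> Y (fun x => v (i2, x)).
  by move=> i; case: (ltnP i N) => [/hP[Y h]|_]; [exists Y|exists (fun=> True)].
have [J1 hJ1] : exists J, forall i, i < N -> forall J', J <= J' -> exists i1 i2,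
    [/\ i1 < J', i2 < J' &
    P i = fun v => Y i (fun x => v (i1, x)) <-> Y i (fun x => v (i2, x))].
  apply: uniform_bound => i /hY[i1 [i2 Pi]]; exists (maxn i1 i2).+1 => J'.
  by rewrite gtn_max => /andP[h1 h2]; exists i1, i2.
have [sup hsup] := definable_support dS.
have [J2 hJ2] : exists J, forall ix, List.In ix sup -> ix.1 < J.
  elim: (sup) => [|ix r [J hJ]]; first by exists 0.
  exists (maxn J ix.1.+1) => y [<-|/hJ yJ]; first by rewrite leq_max leqnn orbT.
  by rewrite leq_max yJ.
pose J := maxn J1 J2.
pose F := {ffun 'I_N -> bool}.
pose R := J * #|F|.
pose ext (v : nat * 'I_m -> U) (g : nat -> nat) (i : nat) (x : 'I_m) : U :=
  if i < J then v (g i, x) else sval a0.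
pose unc (e : nat -> 'I_m -> U) (ix : nat * 'I_m) := e ix.1 ix.2.
have dA : seq_definable M (fun e => S (unc e)).
  by apply: definable_ext dS => v; suff -> : unc (fun i x => v (i, x)) = v by [];
    apply/funext => -[].
have Ssup e e' : (forall j, j < J -> e j = e' j) -> S (unc e) -> S (unc e').
  move=> h; apply: hsup => ix /hJ2 ixJ; rewrite /unc h //.
  by rewrite leq_max ixJ orbT.
have Sg g : increasing_below J g -> S (unc (ext (unc s) g)).
  move=> hg; have : S (unc (s \o id)) by [].
  move/(indiscernible_transfer ind dA Ssup (@increasing_id J) hg).
  by apply: Ssup => j jJ; apply/funext => x; rewrite /ext jJ.
pose ext0 (gf : {ffun 'I_J -> 'I_R.+1}) (i : nat) : nat :=
  if insub i is Some i' then val (gf i') else 0.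
(* An [M]-valued approximation [v] of [s]: every increasing choice of [J] indices not exceeding [R]
   satisfies [S]. *)
have [||v Mv hv] := @tarski_vaught _ _ _ elM _ (fun v => forall gf : {ffun 'I_J -> 'I_R.+1},
  increasing_below J (ext0 gf) -> S (unc (ext v (ext0 gf)))).
- apply: definable_forall => gf.
  apply: definable_imp; first exact: definable_const.
  apply: (seq_definable_coord (F := fun v => ext v _)) dA => i x.
  rewrite /ext; case: (i < J); first by left; eexists; reflexivity.
  by right; exists (sval a0) => //; apply: svalP.
- by exists (unc s) => gf; apply: Sg.
(* The colour of an index records which of the finitely many sets [Y l] contain its tuple, so a
   monochromatic subsequence satisfies all the required equivalences. *)
have [g [ginc gR [col hcol]]] := monochromatic_subsequence
  (fun i => [ffun l : 'I_N => `[<Y l (fun x => v (i, x))>]] : F) J.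
pose gf : {ffun 'I_J -> 'I_R.+1} := [ffun i : 'I_J => inord (g i)].
have gfE i : i < J -> ext0 gf i = g i.
  move=> iJ; rewrite /ext0; case: insubP => [i' _ ii'|]; last by rewrite iJ.
  by rewrite ffunE -ii' /= inordK // ltnS ii' ltnW // gR.
exists (unc (ext v g)); split.
- move=> [i x]; rewrite /unc /ext /=; case: ifP => _; first exact: Mv.
  exact: svalP.
- have := hv gf; have : increasing_below J (ext0 gf).
    move=> i t /andP[it tJ]; rewrite !gfE //; last exact: ltn_trans tJ.
    by apply: ginc; rewrite it.
  move=> hi /(_ hi); apply: Ssup => j jJ; apply/funext => x.
  by rewrite /ext jJ gfE.
- move=> i iN; have [i1 [i2 [h1 h2 ->]]] := hJ1 i iN J (leq_maxl _ _).
  have colE j : j < J -> `[<Y i (fun x => v (g j, x))>] = col (Ordinal iN).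
    by move=> jJ; rewrite -(hcol j jJ) ffunE.
  have extE j : j < J -> (fun x => unc (ext v g) (j, x)) = fun x => v (g j, x).
    by move=> jJ; apply/funext => x; rewrite /unc /ext /= jJ.
  rewrite !extE //.
  have eqc := colE _ h1; rewrite -(colE _ h2) in eqc.
  by split=> H; apply/asboolP; [rewrite -eqc|rewrite eqc]; apply/asboolP.
Qed.

Variables (n : nat) (p : set (pformula U n)).
Hypothesis pM : p `<=` formula_over M.
Hypothesis ntp : NTP2 p.

(** Otherwise, take [E]-generic copies of the whole indiscernible sequence as rows: they are
    [k]-inconsistent by indiscernibility, while every path is [D]-generic and hence consistent with
    each finite part of [p], against NTP2. *)
Lemma dividing_coheir (psi : pformula U n) : formula_divides M psi ->
  exists D theta, [/\ coheir M (pparam psi) D, finite_part p theta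
    & divides_along D (fun x y => theta x /\ sat (pform psi) (copair x y))].
Proof.
move=> [s [ind s0 incons]].
pose Psi (x : 'I_n -> U) (y : 'I_(pnum psi) -> U) := sat (pform psi) (copair x y).
have [a0] := elementary_sig elM.
have dPsi : definable2 M Psi.
  exists (rename (pform psi) inl) => v; rewrite sat_rename.
  by split; apply: sat_ext => -[].
have [k hk] : exists k, ~ exists x, forall t, t < k -> Psi x (s t).
  apply: contrapT => h; apply: incons => q fq sq.
  have [|N [theta [[q' [_ q0 ->]] ht]]] :=
    @finite_subset_range L U n set0 (fun i => PFormula (pform psi) (s i)) q fq.
    by move=> chi /sq; left.
  have [x hx] : exists x, forall t, t < N -> Psi x (s t).
    by apply: contrapT => hN; apply: h; exists N.
  by exists x; apply: ht => // chi /q0.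
have [E cE EY] := indiscernible_coheir ind.
have [uE EM hE] := cE.
pose pr i (v : nat * 'I_(pnum psi) -> U) x := v (i, x).
pose D (P : ('I_(pnum psi) -> U) -> Prop) := E (fun v => P (pr 0 v)).
have uD : ultra D.
  split=> [P Q h|P Q|P]; last exact: (ultra_not uE).
    by apply: (ultra_mono uE) => v; apply: h.
  exact: (ultra_and uE).
have cD : coheir M (pparam psi) D.
  split=> //; first by apply: (ultra_mono uE _ EM) => v Mv x; apply: Mv.
  move=> S dS Sd; apply: hE; first exact: (definable_rename (fun x => (0, x)) dS).
  by rewrite /pr /= (_ : (fun x => s 0 x) = pparam psi) //; apply/funext.
have DE P i : D P -> E (fun v => P (pr i v)).
  by move=> DP; apply: (ultra_mono2 uE _ DP (EY P 0 i)) => v h [H _]; apply: H.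
apply: contrapT => nd.
apply: (@ntp2_array K L U M satU elM smallM n p _ pM ntp Psi k dPsi) => -[//|J] theta _ pt.
have : ~ divides_along D (fun x y => theta x /\ Psi x y).
  by move=> h; apply: nd; exists D, theta.
move/(not_divides_along J.+1 (fun _ _ => sval a0) uD) => gD.
have rows : E (fun v => inconsistent_row Psi k J.+1 (fun i => pr i v)).
  apply: (ultra_inconsistent_row uE) => g ginc gJ; apply: hE.
    apply: definable_not.
    apply: (seq_definable_coord (A := fun e => exists x, forall t, t < k -> Psi x (e t))
      (F := fun v t x => v (g t, x))).
      by move=> i x; left; eexists; reflexivity.
    exact: seq_definable_inconsistent.
  move=> H; apply: hk.
  apply: (indiscernible_transfer (A := fun e => exists x, forall t, t < k -> Psi x (e t))
     (J := k) (g := g) (g' := id) ind _ _ ginc _ _) => //.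
  - exact: seq_definable_inconsistent.
  - by move=> e e' ee' [x hx]; exists x => t tk; rewrite -ee' //; apply: hx.
  - exact: increasing_id.
(* Only finitely many paths cross a square of side [J.+1], so one generic array serves them all. *)
have paths (f : {ffun 'I_J.+1 -> 'I_J.+1}) : gen (nseq J.+1 E) (fun e => exists x,
    theta x /\ forall al : 'I_J.+1, Psi x (pr (f al) (e al))) (fun _ _ => sval a0).
  have := gen_path (proj := pr) (fun al => val (f (inord al))) (fun _ _ => sval a0)
    uD uE DE gD.
  apply: gen_mono; first exact: Forall_nseq.
  move=> e [x hx]; exists x; split=> [|al].
    by have [] := hx 0 isT.
  by have [_] := hx al (ltn_ord al); rewrite /splice ltn_ord inord_val.
have uG := gen_nseq_ultra J.+1 (fun _ _ => sval a0) uE.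
have [e [rowse pathse]] := ultra_ex uG (ultra_and uG
  (gen_nseq_all J.+1 (fun _ _ => sval a0) uE rows) (ultra_forall uG paths)).
exists (fun al i => pr i (e al)); split=> [al alJ|f fJ]; first exact: rowse.
have [x [tx hx]] := pathse [ffun al : 'I_J.+1 => inord (f al)].
exists x; split=> // al alJ; have := hx (Ordinal alJ).
by rewrite ffunE /= inordK // fJ.
Qed.

End Dividing.

(** * Kim's lemma for strict coheirs *)

Section Kim.
Variables (K : Type) (L : language) (U : structure L) (M : set U).
Hypothesis satU : saturated K U.
Hypothesis elM : elementary_submodel M.
Hypothesis smallM : forall F, finite_set F -> smaller_than K (M `|` F).
Variables (n : nat) (p : set (pformula U n)).
Hypothesis pM : p `<=` formula_over M.
Hypothesis ntp : NTP2 p.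
Variables (V : finType) (c : V -> U) (R : ((V -> U) -> Prop) -> Prop).
Hypothesis cR : coheir M c R.
Hypothesis strictR : forall (Z : Type) (psi : (Z -> U) -> (V -> U) -> Prop) b D,
  definable2 M psi -> R (psi b) -> coheir M c D -> ~ divides_along D psi.

(* The rows are chosen one after the other; each time strictness of [R] turns
   the previous rows into ones over which a whole new row is of constant type. *)
Lemma strict_rows (D : ((V -> U) -> Prop) -> Prop) (J : nat)
    (rho : (nat -> V -> U) -> Prop) (r : nat) :
  coheir M c D -> 0 < J -> seq_definable M rho -> (forall e, gen (nseq J D) rho e) ->
  exists b : nat -> nat -> V -> U, (forall al, al < r -> rho (b al)) /\
    forall f, (forall al, f al < J) -> forall A e0, seq_definable M A ->
      (forall i x, M (e0 i x)) -> gen (nseq r R) A e0 ->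
      A (splice r (fun al => b al (f al)) e0).
Proof.
move=> cD J0 drho grho; have [a0] := elementary_sig elM.
have [uD _ _] := cD; have [uR RM _] := cR.
elim: r => [|r [b [rows paths]]].
  by exists (fun _ _ _ => sval a0); split=> // f fJ A e0 _ _; rewrite splice0.
pose Z : countType := (nat * nat * V)%type.
pose W : countType := (Z + nat * V)%type.
pose unc (d : nat -> nat -> V -> U) (z : Z) := d z.1.1 z.1.2 z.2.
pose tl (w : W -> U) (t : nat) (x : V) : U := w (inr (t, x)).
(* [w] consists of a copy of the previous rows and a new row satisfying [rho]. Jointly with the
   copy, each of the first [J] entries of the new row has the type over [M] of [b] followed by a
   realization of [R] over [M] and [b]. *)
have [|N P hP|w hw] := @realize_countable K L U satU M a0 W
   (fun S => (exists psi : (Z -> U) -> (V -> U) -> Prop, exists t, [/\ definable2 M psi,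
       R (psi (unc b)), t < J & S = fun w => psi (w \o inl) (tl w t)]) \/
     S = fun w => rho (tl w)) smallM.
- move=> S [[psi [t [dpsi _ _ ->]]]|->].
    apply: definable2_coord dpsi => y; left; first by exists (inl y).
    by exists (inr (t, y)).
  by apply: seq_definable_coord drho => t x; left; exists (inr (t, x)).
- have /choice[psi hpsi] : forall i, exists psi : (Z -> U) -> (V -> U) -> Prop,
      [/\ definable2 M psi, R (psi (unc b)) & i < N ->
        (exists2 t, t < J & P i = fun w => psi (w \o inl) (tl w t)) \/
        P i = fun w => rho (tl w)].
    have dT : definable2 M (fun (_ : Z -> U) (_ : V -> U) => True).
      exact: definable_const.
    move=> i; case: (ltnP i N) => [/hP[[psi [t [h1 h2 h3 h4]]]|h]|_].
    + by exists psi; split=> // _; left; exists t.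
    + by exists (fun _ _ => True); split=> // [|_]; [apply: (ultra_true uR)|right].
    + by exists (fun _ _ => True); split=> //; apply: (ultra_true uR).
  pose Psi z y := forall i, i < N -> psi i z y.
  have dPsi : definable2 M Psi by apply: definable_forall_lt => i _; have [] := hpsi i.
  have RPsi : R (Psi (unc b)).
    by apply: (ultra_forall_lt uR) => i _; have [] := hpsi i.
  pose e0 : nat -> V -> U := fun _ _ => sval a0.
  (* By strictness [Psi] does not divide along [D]: on a [D]-generic row some [z] satisfies [Psi]
     with all [J] entries at once. *)
  have h1 := not_divides_along J e0 uD (strictR dPsi RPsi cD).
  have [y [[z hz] ry]] :=
    ultra_ex (gen_nseq_ultra J e0 uD) (ultra_and (gen_nseq_ultra J e0 uD) h1 (grho e0)).
  exists (copair z (fun tx => y tx.1 tx.2)) => i iN.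
  by have [_ _ /(_ iN)[[t tJ ->]|->]] := hpsi i; [apply: hz|].
pose b' al : nat -> V -> U := if al < r then fun t x => w (inl (al, t, x)) else tl w.
have hw' (psi : (Z -> U) -> (V -> U) -> Prop) t : definable2 M psi ->
    R (psi (unc b)) -> t < J -> psi (w \o inl) (tl w t).
  move=> h1 h2 h3; apply: (hw (fun w => psi (w \o inl) (tl w t))).
  by left; exists psi, t.
exists b'; split=> [al|f fJ A e0 dA Me0].
  rewrite ltnS leq_eqVlt /b' => /orP[/eqP ->|alr].
    by rewrite ltnn; apply: (hw (fun w => rho (tl w))); right.
  rewrite alr; apply: (hw' (fun z _ => rho (fun t x => z (al, t, x))) 0) => //.
    by apply: seq_definable_coord drho => t x; left; exists (inl (al, t, x)).
  by apply: (ultra_true uR) => _; apply: rows.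
(* The last generic is quantified outermost. It is taken from the new row, and the paths through the
   earlier rows are handled with an [M]-point [y] in its place. *)
rewrite -addn1 nseqD gen_cat /= => gA.
pose psi (z : Z -> U) (y : V -> U) :=
  A (splice r (fun al x => z (al, f al, x)) (scons y e0)).
have := hw' psi (f r) _ _ (fJ r).
have -> : psi (w \o inl) (tl w (f r)) = A (splice (r + 1) (fun al => b' al (f al)) e0).
  rewrite /psi; congr A; apply/funext => j; rewrite /splice addn1 ltnS /b'.
  case: ltngtP => [jr|jr|->]; last by rewrite subnn /=.
    by apply/funext => x.
  by rewrite -subnSK.
apply.
- apply: seq_definable_coord dA => j x; rewrite /splice; case: (j < r).
    by left; exists (inl (j, f j, x)).
  case: (j - r) => [|i] /=; first by left; exists (inr x).
  by right; exists (e0 i x).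
- apply: (ultra_mono2 uR _ RM gA) => y My gy.
  apply: (paths f fJ A (scons y e0) dA _ gy) => -[|i] x //=.
Qed.

(** Otherwise [strict_rows] gives an array whose rows look like Morley sequences of [D], hence are
    [k]-inconsistent, while its paths look like Morley sequences of [R], hence are consistent with
    the finite parts of [p], against NTP2. *)
Lemma divides_along_strict (D : ((V -> U) -> Prop) -> Prop)
    (psi : ('I_n -> U) -> (V -> U) -> Prop) :
  coheir M c D -> definable2 M psi -> divides_along D psi ->
  exists2 theta, finite_part p theta & divides_along R (fun x y => theta x /\ psi x y).
Proof.
move=> cD dpsi [k hk]; have [a0] := elementary_sig elM.
have [uD _ _] := cD; have [uR _ _] := cR.
apply: contrapT => nd.
apply: (@ntp2_array K L U M satU elM smallM n p _ pM ntp psi k dpsi) => -[//|J] theta _ pt.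
have : ~ divides_along R (fun x y => theta x /\ psi x y).
  by move=> h; apply: nd; exists theta.
move/(not_divides_along J.+1 (fun _ _ => sval a0) uR) => gR.
have grho e : gen (nseq J.+1 D) (inconsistent_row psi k J.+1) e.
  apply: (@ultra_inconsistent_row _ _ _ (fun A => gen (nseq J.+1 D) A e) psi k J.+1 id
    (gen_nseq_ultra _ _ uD)) => g ginc gJ.
  have := gen_incr e uD ginc gJ (hk e).
  apply: gen_mono; first exact: Forall_nseq.
  move=> e' h [x hx]; apply: h; exists x => t tk.
  by rewrite /splice tk /=; apply: hx.
have [b [rows paths]] := strict_rows J.+1 cD (ltn0Sn J)
  (inconsistent_row_definable k J.+1 elM dpsi) grho.
exists b; split=> [al alJ|f fJ]; first exact: rows.
have dthpsi : definable2 M (fun x y => theta x /\ psi x y).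
  apply: definable_and dpsi.
  exact: (definable_rename _ (finite_part_definable pM pt)).
have [|x hx] := paths f fJ _ _ (seq_definable_inconsistent elM J.+1 dthpsi) _ gR.
  by move=> i x; apply: svalP.
exists x; split=> [|al alJ]; first by have [] := hx 0 isT.
by have [_] := hx al alJ; rewrite /splice alJ.
Qed.

End Kim.

(** * Morley sequences of a coheir *)

Section Morley.
Variables (K : Type) (L : language) (U : structure L) (M : set U).
Hypothesis satU : saturated K U.
Hypothesis elM : elementary_submodel M.
Hypothesis smallM : forall F, finite_set F -> smaller_than K (M `|` F).
Variables (V : finType) (c : V -> U) (R : ((V -> U) -> Prop) -> Prop) (u0 : U).
Hypothesis cR : coheir M c R.
Hypothesis Mu0 : M u0.

Let e0 : nat -> V -> U := fun _ _ => u0.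

(** The entry at 0 is the innermost generic. Once the later entries lie in [M], a definable
    condition on it holds for [R]-almost all points exactly when it holds of [c], so the sequence
    can start with [c] itself. *)
Lemma morley_sequence : exists cs : nat -> V -> U, cs 0 = c /\
  forall N A, seq_definable M A -> gen (nseq N R) A e0 -> A (splice N cs e0).
Proof.
have [uR RM _] := cR.
have Au0 : (M `|` range c) u0 by left.
pose unc (v : nat * V -> U) i x := v (i, x).
have [F finF|S [N [A [dA _ ->]]]|N0 P hP|e he] :=
  @realize_countable K L U satU (M `|` range c) (exist _ u0 Au0) (nat * V)%type
  (fun S => exists N A, [/\ seq_definable M A, gen (nseq N R) A e0
     & S = fun v => A (splice N (scons c (unc v)) e0)]).
- by rewrite -setUA; apply: smallM; rewrite finite_setU; split=> //; apply: finite_image.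
- have := definable_mono (@subsetUl _ M (range c)) dA.
  apply: (definable_coord (F := fun v ix => splice N (scons c (unc v)) e0 ix.1 ix.2)).
  move=> [j x]; rewrite /splice /=; case: (j < N); last by right; exists u0.
  case: j => [|j] /=; first by right; exists (c x) => //; right; exists x.
  by left; exists (j, x).
- have /choice[N hN] : forall i, exists N, i < N0 -> exists A, [/\ seq_definable M A,
      gen (nseq N R) A e0 & P i = fun v => A (splice N (scons c (unc v)) e0)].
    by move=> i; case: (ltnP i N0) => [/hP[N h]|_]; [exists N|exists 0].
  have /choice[A hA] : forall i, exists A, i < N0 -> [/\ seq_definable M A,
      gen (nseq (N i) R) A e0 & P i = fun v => A (splice (N i) (scons c (unc v)) e0)].
    by move=> i; case: (ltnP i N0) => [/hN[A h]|_]; [exists A|exists (fun=> True)].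
  have [J hJ] : exists J, forall i, i < N0 -> forall J', J <= J' -> N i <= J'.
    by apply: uniform_bound => i _; exists (N i).
  pose B e := forall i, i < N0 -> A i (splice (N i) e e0).
  have dB : seq_definable M B.
    apply: definable_forall_lt => i /hA[dA _ _].
    apply: (seq_definable_coord (F := fun v => splice (N i) (fun i x => v (i, x)) e0)) dA.
    move=> j x; rewrite /splice; case: (j < N i); first by left; exists (j, x).
    by right; exists u0.
  have gB : gen (nseq J.+1 R) B e0.
    apply: (ultra_forall_lt (gen_nseq_ultra J.+1 e0 uR)) => i iN.
    have [_ gA _] := hA i iN.
    apply: (gen_incr (g := id) e0 uR _ _ gA); first exact: increasing_id.
    by move=> t tN; apply: leq_trans tN (hJ i iN _ (leqnSn J)).
  have uF := Forall_nseq J uR.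
  have gM : gen (nseq J R) (fun e => forall j x, M (e j x)) e0.
    by apply: (gen_points uF (Forall_nseq J RM)) => j x.
  have [e [Be Me]] := ultra_ex (gen_ultra e0 uF) (ultra_and (gen_ultra e0 uF) gB gM).
  exists (fun ix => e ix.1 ix.2) => i iN; have [_ _ ->] := hA i iN.
  by have := (coheir_iff cR (definable_slice dB Me)).1 Be; apply.
exists (scons c (unc e)); split=> // N A dA gA.
by apply: (he (fun v => A (splice N (scons c (unc v)) e0))); exists N, A.
Qed.

Variable cs : nat -> V -> U.
Hypothesis morley_cs : forall N A, seq_definable M A -> gen (nseq N R) A e0 ->
  A (splice N cs e0).

Lemma morley_subsequence (k : nat) (g : nat -> nat) A : seq_definable M A ->
  gen (nseq k R) A e0 -> increasing_below k g -> A (splice k (cs \o g) e0).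
Proof.
move=> dA gA ginc; have [uR _ _] := cR.
pose N := \max_(t < k) (g t).+1.
have gN t : t < k -> g t < N by move=> tk; apply: (leq_bigmax_cond (Ordinal tk)).
have dA' : seq_definable M (fun e => A (splice k (e \o g) e0)).
  apply: (seq_definable_coord (F := fun v => splice k ((fun i x => v (i, x)) \o g) e0)) dA.
  move=> j x; rewrite /splice; case: (j < k); first by left; exists (g j, x).
  by right; exists u0.
have := morley_cs dA' (gen_incr e0 uR ginc gN gA).
suff -> : splice k (splice N cs e0 \o g) e0 = splice k (cs \o g) e0 by [].
by apply/funext => j; rewrite /splice /=; case: ifP => // jk; rewrite gN.
Qed.

(** Truth of a formula on increasing indices is decided by [gen (nseq k R)], which does not see the
    indices. The map [h] extracts the parameter tuple of a formula, with constants from [M]. *)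
Lemma morley_indiscernible (l : nat) (h : 'I_l -> V + {u | M u}) :
  indiscernible M (fun j => copair (cs j) sval \o h).
Proof.
move=> k r phi d i j Md inci incj; have [uR _ _] := cR.
pose A (e : nat -> V -> U) := sat phi (copair
  (fun tr : 'I_k * 'I_l => copair (e tr.1) sval (h tr.2)) d).
have dA : seq_definable M A.
  have dphi : definable M (fun v : 'I_k * 'I_l + 'I_r -> U => sat phi v).
    by exists (rename phi inl) => v; rewrite sat_rename.
  apply: (definable_coord (F := fun v => copair (fun tr : 'I_k * 'I_l =>
    copair (fun x => v (nat_of_ord tr.1, x)) sval (h tr.2)) d)) dphi => -[[t s]|t] /=.
    case: (h s) => [x|a] /=; first by left; exists (nat_of_ord t, x).
    by right; exists (sval a) => //; apply: svalP.
  by right; exists (d t).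
have AE (f : 'I_k -> nat) g : (forall t : 'I_k, f t = g (nat_of_ord t)) ->
    A (splice k (cs \o g) e0) =
    sat phi (copair (fun tr : 'I_k * 'I_l => (copair (cs (f tr.1)) sval \o h) tr.2) d).
  move=> fg; rewrite /A; congr sat; apply/funext => -[[t s]|] //=.
  by rewrite fg /splice ltn_ord.
pose ext (f : 'I_k -> nat) t := if insub t is Some t' then f t' else 0.
have extE f (t : 'I_k) : f t = ext f (nat_of_ord t) by rewrite /ext valK.
have incext f : (forall t t' : 'I_k, t < t' -> f t < f t') -> increasing_below k (ext f).
  move=> incf s t /andP[st tk]; have sk := ltn_trans st tk.
  have := incf (Ordinal sk) (Ordinal tk) st.
  by rewrite (extE f (Ordinal sk)) (extE f (Ordinal tk)).
suff H f : (forall t t' : 'I_k, t < t' -> f t < f t') ->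
    (gen (nseq k R) A e0 <-> sat phi (copair
      (fun tr : 'I_k * 'I_l => (copair (cs (f tr.1)) sval \o h) tr.2) d)).
  by rewrite -(H _ inci) -(H _ incj).
move=> /incext incf; rewrite -(AE f _ (extE f)); split=> [gA|].
  exact: morley_subsequence.
move=> Acs; apply: contrapT => /(ultra_not (gen_nseq_ultra k e0 uR)) gnA.
exact: (morley_subsequence (definable_not dA) gnA incf) Acs.
Qed.

End Morley.

Lemma falsum_divides (L : language) (U : structure L) (A : set U) (n : nat) (u : U) :
  formula_divides A (PFormula (Falsum : formula L ('I_n + 'I_0)) (fun=> u)).
Proof.
pose bot := PFormula (Falsum : formula L ('I_n + 'I_0)) (fun=> u).
exists (fun _ _ => u); split=> // h.
have [||x /(_ bot)[]] := h (range (fun i : nat => bot)) => //; last by exists 0.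
by apply: (@sub_finite_set _ _ [set bot]) => // _ [i _ <-].
Qed.

Lemma divides_along_lift (L : language) (U : structure L) (Z V W : Type) (h : W -> V)
    (D : ((W -> U) -> Prop) -> Prop) (D' : ((V -> U) -> Prop) -> Prop)
    (psi : Z -> (W -> U) -> Prop) :
  ultra D -> ultra D' -> (forall P, D P -> D' (fun v => P (v \o h))) ->
  divides_along D psi -> divides_along D' (fun x v => psi x (v \o h)).
Proof.
move=> uD uD' DD' [k hk]; exists k => e.
have := gen_path (proj := fun _ v => v \o h) id e uD uD' (fun P _ => DD' P)
  (hk (fun i => e i \o h)).
apply: gen_mono; first exact: Forall_nseq.
move=> e' H [x hx]; apply: H; exists x => t tk; rewrite /splice tk; exact: hx.
Qed.

Lemma finite_part_forall_ord (L : language) (U : structure L) (n : nat)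
    (p : set (pformula U n)) (N : nat) (t : 'I_N -> ('I_n -> U) -> Prop) :
  (forall i, finite_part p (t i)) -> finite_part p (fun x => forall i, t i x).
Proof.
move=> h.
have := @finite_part_forall L U n p N
  (fun i => if insub i is Some i' then t i' else fun=> True).
have -> : (fun x => forall i, i < N -> (if insub i is Some i' then t i' else fun=> True) x) =
    fun x => forall i, t i x.
  apply/funext => x; apply/propext; split=> [hx i|hx i iN].
    by have := hx i (ltn_ord i); rewrite valK.
  by case: insubP.
by apply=> i iN; case: insubP => // _; exact: finite_part_true.
Qed.

(** * From forking to dividing in the presence of [p], and the extension theorem *)

Section Main.
Variables (K : Type) (L : language) (U : structure L) (M : set U).
Hypothesis satU : saturated K U.
Hypothesis elM : elementary_submodel M.
Hypothesis smallM : forall F, finite_set F -> smaller_than K (M `|` F).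
Variables (n : nat) (p : set (pformula U n)).
Hypothesis pM : p `<=` formula_over M.
Hypothesis ntp : NTP2 p.

Lemma divides_of_forks (m : nat) (phi : formula L ('I_n + 'I_m)) (a : 'I_m -> U)
    (theta0 : ('I_n -> U) -> Prop) (N : nat) (psi : nat -> pformula U n) :
  finite_part p theta0 -> (forall i, formula_divides M (psi i)) ->
  (forall x, theta0 x -> sat phi (copair x a) ->
     exists2 i, i < N & psat (psi i) x) ->
  type_divides M ([set PFormula phi a] `|` p).
Proof.
move=> pt0 dpsi forks; have [u0 Mu0] := elementary_point elM.
pose a0 : {u | M u} := exist _ u0 Mu0.
(* [c] gathers [a] and the parameters of all the dividing formulas, so that one strict coheir serves
   them all. *)
pose V : finType := ('I_m + {i : 'I_N & 'I_(pnum (psi i))})%type.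
pose c : V -> U := copair a
  (fun w : {i : 'I_N & 'I_(pnum (psi i))} => pparam (psi (tag w)) (tagged w)).
pose pr (i : 'I_N) (j : 'I_(pnum (psi i))) : V :=
  inr (Tagged (fun i : 'I_N => 'I_(pnum (psi i))) j).
pose Psi (i : 'I_N) (x : 'I_n -> U) (y : V -> U) :=
  sat (pform (psi i)) (copair x (y \o @pr i)).
have dPsi i th : finite_part p th -> definable2 M (fun x y => th x /\ Psi i x y).
  move=> pth; apply: definable_and.
    exact: (definable_rename _ (finite_part_definable pM pth)).
  exists (rename (pform (psi i)) (inl \o copair inl (inr \o @pr i))) => v.
  by rewrite sat_rename; split; apply: sat_ext => -[].
have [R cR strictR] := strict_coheir elM c.
have [uR _ _] := cR.
have /choice[Th hTh] : forall i, exists Th, finite_part p Th /\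
    divides_along R (fun x y => Th x /\ Psi i x y).
  move=> i; have [D [th [cD pth div]]] := dividing_coheir satU elM smallM pM ntp (dpsi i).
  have [D' cD' DD'] := @coheir_lift L U M elM V _ (@pr i) c D cD.
  have [uD _ _] := cD; have [uD' _ _] := cD'.
  have := divides_along_lift uD uD' DD' div.
  move/(divides_along_strict satU elM smallM pM ntp cR strictR cD' (dPsi i _ pth)).
  move=> [th' pth' div'].
  exists (fun x => th' x /\ th x); split; first exact: finite_part_and.
  have [k hk] := div'; exists k => e; move: (hk e); apply: gen_mono; first exact: Forall_nseq.
  by move=> e' H [x hx]; apply: H; exists x => t /hx[[? ?] ?].
have /choice[kk hkk] := fun i => (hTh i).2.
pose J := \max_(i < N) kk i.
pose ThN x := theta0 x /\ forall i, Th i x.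
have pThN : finite_part p ThN.
  by apply: finite_part_and => //; apply: finite_part_forall_ord => i; have [] := hTh i.
have [cs [cs0 morley]] := morley_sequence satU smallM cR Mu0.
(* [J * N] terms suffice for a monochromatic subsequence of length [J]; the successor makes [l]
   positive. *)
pose l := (J * N).+1.
have [[x [[tx Thx] phix]]|nx] := pselect (exists x, ThN x /\
    forall j, j < l -> sat phi (copair x (cs j \o inl))).
  exfalso.
  have forksj j : j < l -> exists i, Psi i x (cs j).
    (* [Q] says that [theta0] and [phi] imply the disjunction; being over [M] and true of [c], it
       passes to [cs j]. The conjunct [True] gives the shape expected by [dPsi]. *)
    move=> jl; pose Q (y : V -> U) := ~ exists x : 'I_n -> U,
      (theta0 x /\ sat phi (copair x (y \o inl))) /\ forall i, ~ (True /\ Psi i x y).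
    have dQ : definable M Q.
      apply: definable_not.
      apply: (definable_ex a0 (S := fun v : V + 'I_n -> U =>
        (theta0 (v \o inr) /\ sat phi (copair (v \o inr) (v \o inl \o inl))) /\
        forall i, ~ (True /\ Psi i (v \o inr) (v \o inl)))).
      apply: definable_and.
        apply: definable_and; first exact: (definable_rename _ (finite_part_definable pM pt0)).
        exists (rename phi (copair (inl \o inr) (inl \o inl \o inl))) => v.
        by rewrite sat_rename; split; apply: sat_ext => -[].
      apply: definable_forall => i; apply: definable_not.
      apply: definable2_coord (dPsi i _ (finite_part_true p)) => y; left.
        by exists (inr y).
      by exists (inl y).
    have Qc : Q c.
      move=> [y [[ty phiy] nPsi]]; have [i iN Psiy] := forks y ty phiy.
      by apply: (nPsi (Ordinal iN)); split=> //; move: Psiy; apply: sat_ext => -[].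
    have inc1 : increasing_below 1 (fun=> j) by move=> s [|t] /andP[].
    have : Q (cs j).
      apply: (morley_subsequence cR Mu0 morley (A := fun e => Q (e 0)) _ _ inc1).
        exact: (definable_rename (fun x => (0, x)) dQ).
      exact: ((coheir_iff cR dQ).2 Qc).
    move=> nex; apply: contrapT => nPsi; apply: nex; exists x.
    by split=> [|i [_ h]]; [split=> //; apply: phix|apply: nPsi; exists i].
  have [i0 _] := forksj 0 isT.
  have /choice[col hcol] : forall j, exists i, j < l -> Psi i x (cs j).
    by move=> j; case: (ltnP j l) => [/forksj[i h]|_]; [exists i|exists i0].
  have [g [ginc gl [i hi]]] := monochromatic_subsequence col J.
  have kJ : kk i <= J by apply: leq_bigmax_cond.
  have gincK : increasing_below (kk i) g.
    by move=> s t /andP[st tk]; apply: ginc; rewrite st (leq_trans tk).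
  have := morley_subsequence cR Mu0 morley
    (definable_not (seq_definable_inconsistent elM (kk i) (dPsi i _ (hTh i).1)))
    (hkk i _) gincK.
  apply; exists x => t tk; split=> //; rewrite /splice tk /= -(hi t (leq_trans tk kJ)).
  apply: hcol; rewrite ltnS ltnW // (leq_trans (gl t (leq_trans tk kJ))) //.
  by rewrite card_ord.
(* The formula that divides is [phi] strengthened by the finite part [ThN] of [p]; its conjugates
   along [cs] are inconsistent. *)
have dPhi : definable M (fun v : 'I_n + 'I_m -> U => ThN (v \o inl) /\ sat phi v).
  apply: definable_and; first exact: (definable_rename _ (finite_part_definable pM pThN)).
  by exists (rename phi inl) => v; rewrite sat_rename.
have [r [f [h hf]]] := definable_split a0 dPhi.
exists (PFormula f (copair a sval \o h)); split.
  move=> cons; have [q [fq qp thq]] := pThN.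
  have [||x hx] := cons ([set PFormula phi a] `|` q `|`
    [set pnot (PFormula f (copair a sval \o h))]).
  - by rewrite !finite_setU.
  - by move=> chi [[->|/qp]|->]; [left; left|left; right|right].
  have : ~ sat f (copair x (copair a sval \o h)).
    exact: (hx (pnot (PFormula f (copair a sval \o h))) (or_intror erefl)).
  apply; apply/hf; split; last by apply: (hx (PFormula phi a)); left; left.
  by rewrite thq => chi qchi; apply: hx; left; right.
pose h' j : V + {u | M u} := match h j with inl y => inl (inl y) | inr u => inr u end.
have hh' j : copair (cs j) sval \o h' = copair (cs j \o inl) sval \o h.
  by apply/funext => t; rewrite /= /h'; case: (h t).
exists (fun j => copair (cs j) sval \o h'); split.
- exact: (morley_indiscernible cR Mu0 morley).
- by move=> t; rewrite hh' cs0.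
move=> cons; apply: nx.
have [||x hx] := cons ((fun j => PFormula f (copair (cs j) sval \o h')) @` `I_l).
- exact: finite_image.
- by move=> _ [j _ <-]; exists j.
have hxj j : j < l -> ThN x /\ sat phi (copair x (cs j \o inl)).
  move=> jl; apply/hf; rewrite -hh'.
  by apply: (hx (PFormula f (copair (cs j) sval \o h'))); exists j.
by exists x; split=> [|j /hxj[]]; have [] := hxj 0 isT.
Qed.

End Main.

Theorem proposition4p21 (L : language) (T : set (sentence L)) (K : Type)
    (U : structure L) (M : set U) (n : nat) (p : set (pformula U n))
    (m : nat) (phi : formula L ('I_n + 'I_m)) (a : 'I_m -> U) :
  complete_theory T ->
  monster_model T K U ->
  elementary_submodel M ->
  smaller_than K M ->
  partial_type M p ->
  NTP2 p ->
  (forall j, realizations_and p M (a j)) ->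
  ~ type_divides M ([set PFormula phi a] `|` p) ->
  exists p' : set (pformula U n),
    [/\ complete_type (realizations_and p M) p',
        ~ type_divides M p'
      & [set PFormula phi a] `|` p `<=` p'].
Proof.
move=> _ [_ smallL satU _] elM sM [pM _] ntp aC ndiv.
have smallM F : finite_set F -> smaller_than K (M `|` F).
  exact: smaller_setU_finite smallL sM.
have [u0 Mu0] := elementary_point elM.
pose bot := PFormula (Falsum : formula L ('I_n + 'I_0)) (fun=> u0).
have dbot : formula_divides M bot by exact: falsum_divides.
have [|G uG hG] := @ultra_fip ('I_n -> U) (fun P =>
    (exists2 psi, ([set PFormula phi a] `|` p) psi & P = psat psi) \/
    (exists2 psi, formula_divides M psi & P = fun x => ~ psat psi x)).
  move=> N P hP; apply: contrapT => nx; apply: ndiv.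
  (* Each [P i] is traded for a finite part of [p] and a dividing formula to be avoided, with [bot]
     as the default when there is none. An empty intersection then means that [p] and [phi] imply
     the disjunction of these formulas. *)
  have /choice[psi hpsi] : forall i, exists psi : pformula U n, formula_divides M psi /\
      (i < N -> exists2 theta, finite_part p theta &
         forall x, theta x -> sat phi (copair x a) -> ~ psat psi x -> P i x).
    move=> i; case: (ltnP i N) => [/hP[[chi [->|pchi] ->]|[psi dpsi ->]]|_].
    - exists bot; split=> // _.
      by exists (fun=> True) => //; exact: finite_part_true.
    - exists bot; split=> // _.
      by exists (psat chi) => //; exact: finite_part1.
    - exists psi; split=> // _; exists (fun=> True) => //; exact: finite_part_true.
    - by exists bot.
  have /choice[theta htheta] : forall i, exists theta, finite_part p theta /\ (i < N ->
       forall x, theta x -> sat phi (copair x a) -> ~ psat (psi i) x -> P i x).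
    move=> i; case: (ltnP i N) => [/(hpsi i).2[th h1 h2]|_]; first by exists th.
    by exists (fun=> True); split=> //; exact: finite_part_true.
  have ptheta := finite_part_forall (fun i (_ : i < N) => (htheta i).1).
  apply: (divides_of_forks (N := N) satU elM smallM pM ntp ptheta (fun i => (hpsi i).1)).
  move=> x tx phix.
  apply: contrapT => nN; apply: nx; exists x => i iN.
  apply: ((htheta i).2 iN x (tx i iN) phix) => psix; by apply: nN; exists i.
have MC : M `<=` realizations_and p M by right.
exists [set psi | formula_over (realizations_and p M) psi /\ G (psat psi)]; split.
- split; last first.
    move=> psi hpsi; have [GP|/(ultra_not uG) GnP] := pselect (G (psat psi)).
      by left.
    by right; split.
  split=> [psi []//|q fq qp].
  exact: (ultra_ex uG (ultra_finite (P := @psat L U n) uG fq (fun psi h => (qp psi h).2))).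
(* For a dividing [psi] the complement is [G]-large, so finitely many formulas of the type are
   always realized outside [psi]. *)
- move=> [psi [imp dpsi]]; apply: imp => q fq qp.
  apply: (ultra_ex uG (ultra_finite (P := @psat L U n) uG fq _)) => chi /qp[[]//|->].
  by apply: hG; right; exists psi.
- move=> psi hpsi; split; last by apply: hG; left; exists psi.
  by case: hpsi => [->|/pM h] j; [apply: aC|apply/MC/h].
Qed.
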